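(* Let $ML^n_p=(J^1(T,M),L)$ be a metrical multi-time Lagrange space with $\dim T=p$, $\dim M=n$, let $\Gamma=(M^{(i)}_{(\alpha)\beta},N^{(i)}_{(\alpha)j})$ be its canonical nonlinear connection and let $C\Gamma=(H^\gamma_{\alpha\beta},G^k_{j\gamma},L^i_{jk},C^{i(\gamma)}_{j(k)})$ be its Cartan canonical connection. The curvature d-tensor $\mathbf{R}$ of $C\Gamma$ is determined by the following local components in the adapted basis (all other adapted components vanish). (i) If $p=1$: the (possibly) nonzero components are $R^l_{i1k}$, $R^l_{ijk}$, $P^{l\;(1)}_{i1(k)}$, $P^{l\;(1)}_{ij(k)}$, $S^{l(1)(1)}_{i(j)(k)}$ and the vertical ones $R^{(l)(1)}_{(1)(i)1k}=R^l_{i1k}$, $R^{(l)(1)}_{(1)(i)jk}=R^l_{ijk}$, $P^{(l)(1)\;(1)}_{(1)(i)1(k)}=P^{l\;(1)}_{i1(k)}$, $P^{(l)(1)\;(1)}_{(1)(i)j(k)}=P^{l\;(1)}_{ij(k)}$, $S^{(l)(1)(1)(1)}_{(1)(i)(j)(k)}=S^{l(1)(1)}_{i(j)(k)}$, where $$R^l_{i1k}=\frac{\delta G^l_{i1}}{\delta x^k}-\frac{\delta L^l_{ik}}{\delta t}+G^m_{i1}L^l_{mk}-L^m_{ik}G^l_{m1}+C^{l(1)}_{i(m)}R^{(m)}_{(1)1k},$$ $$R^l_{ijk}=\frac{\delta L^l_{ij}}{\delta x^k}-\frac{\delta L^l_{ik}}{\delta x^j}+L^m_{ij}L^l_{mk}-L^m_{ik}L^l_{mj}+C^{l(1)}_{i(m)}R^{(m)}_{(1)jk},$$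 $$P^{l\;(1)}_{i1(k)}=\frac{\partial G^l_{i1}}{\partial y^k}-C^{l(1)}_{i(k)/1}+C^{l(1)}_{i(m)}P^{(m)\;(1)}_{(1)1(k)},$$ $$P^{l\;(1)}_{ij(k)}=\frac{\partial L^l_{ij}}{\partial y^k}-C^{l(1)}_{i(k)|j}+C^{l(1)}_{i(m)}P^{(m)\;(1)}_{(1)j(k)},$$ $$S^{l(1)(1)}_{i(j)(k)}=\frac{\partial C^{l(1)}_{i(j)}}{\partial y^k}-\frac{\partial C^{l(1)}_{i(k)}}{\partial y^j}+C^{m(1)}_{i(j)}C^{l(1)}_{m(k)}-C^{m(1)}_{i(k)}C^{l(1)}_{m(j)}.$$ (ii) If $p\geq2$: the (possibly) nonzero components are $H^\alpha_{\eta\beta\gamma}$, $R^l_{i\beta\gamma}$, $R^l_{i\beta k}$, $R^l_{ijk}$ and the vertical ones $R^{(l)(\alpha)}_{(\eta)(i)\beta\gamma}=\delta^\alpha_\eta R^l_{i\beta\gamma}+\delta^l_iH^\alpha_{\eta\beta\gamma}$, $R^{(l)(\alpha)}_{(\eta)(i)\beta k}=\delta^\alpha_\eta R^l_{i\beta k}$, $R^{(l)(\alpha)}_{(\eta)(i)jk}=\delta^\alpha_\eta R^l_{ijk}$, where $$H^\alpha_{\eta\beta\gamma}=\frac{\partial H^\alpha_{\eta\beta}}{\partial t^\gamma}-\frac{\partial H^\alpha_{\eta\gamma}}{\partial t^\beta}+H^\mu_{\eta\beta}H^\alpha_{\mu\gamma}-H^\mu_{\eta\gamma}H^\alpha_{\mu\beta},$$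 $$R^l_{i\beta\gamma}=\frac{\delta G^l_{i\beta}}{\delta t^\gamma}-\frac{\delta G^l_{i\gamma}}{\delta t^\beta}+G^m_{i\beta}G^l_{m\gamma}-G^m_{i\gamma}G^l_{m\beta},$$ $$R^l_{i\beta k}=\frac{\delta G^l_{i\beta}}{\delta x^k}-\frac{\delta\Gamma^l_{ik}}{\delta t^\beta}+G^m_{i\beta}\Gamma^l_{mk}-\Gamma^m_{ik}G^l_{m\beta},$$ $$R^l_{ijk}=r^l_{ijk}=\frac{\partial\Gamma^l_{ij}}{\partial x^k}-\frac{\partial\Gamma^l_{ik}}{\partial x^j}+\Gamma^m_{ij}\Gamma^l_{mk}-\Gamma^m_{ik}\Gamma^l_{mj}.$$
   Context: Greek indices run from $1$ to $p$, Latin indices from $1$ to $n$; repeated indices are summed. $T$ has local coordinates $(t^\alpha)$, $M$ has local coordinates $(x^i)$, and $E=J^1(T,M)\to T\times M$ is the first-order jet bundle with induced coordinates $(t^\alpha,x^i,x^i_\alpha)$, which change by $\tilde t^\alpha=\tilde t^\alpha(t^\beta)$, $\tilde x^i=\tilde x^i(x^j)$, $\tilde x^i_\alpha=\frac{\partial\tilde x^i}{\partial x^j}\frac{\partial t^\beta}{\partial\tilde t^\alpha}x^j_\beta$. When $p=1$ one writes $t=t^1$, $y^i=x^i_1$. $h=(h_{\alpha\beta}(t))$ is a fixed semi-Riemannian metric on $T$ with inverse $(h^{\alpha\beta})$ and Christoffel symbols $H^\gamma_{\alpha\beta}$. A d-tensor is a family of local functions on $E$ transforming tensorially under these coordinate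 changes. Metrical multi-time Lagrange space: a pair $(J^1(T,M),L)$ with $L:E\to\mathbb{R}$ smooth and Kronecker $h$-regular, i.e. $\frac12\frac{\partial^2L}{\partial x^i_\alpha\partial x^j_\beta}=h^{\alpha\beta}(t^\gamma)g_{ij}(t^\gamma,x^k,x^k_\gamma)$ with $g_{ij}$ a symmetric d-tensor of rank $n$ and constant signature; $(g^{ij})$ is the inverse of $(g_{ij})$. If $p\geq2$, necessarily $L=h^{\alpha\beta}(t)g_{ij}(t,x)x^i_\alpha x^j_\beta+U^{(\alpha)}_{(i)}(t,x)x^i_\alpha+F(t,x)$ with $U$ a d-tensor and $F$ a smooth function on $T\times M$; put $U^{(\alpha)}_{(i)j}=\frac{\partial U^{(\alpha)}_{(i)}}{\partial x^j}-\frac{\partial U^{(\alpha)}_{(j)}}{\partial x^i}$ and $\Gamma^l_{jk}=\frac{g^{li}}2\left(\frac{\partial g_{ij}}{\partial x^k}+\frac{\partial g_{ik}}{\partial x^j}-\frac{\partial g_{jk}}{\partial x^i}\right)$. Canonical nonlinear connection $\Gamma=(M^{(i)}_{(\alpha)\beta},N^{(i)}_{(\alpha)j})$: $M^{(i)}_{(\alpha)\beta}=-H^\gamma_{\alpha\beta}x^i_\gamma$ (for $p=1$: $-H^1_{11}y^i$), and $$N^{(i)}_{(\alpha)j}=\begin{cases}h_{11}\dfrac{\partial\mathcal{G}^i}{\partial y^j},&p=1\\[2mm]\Gamma^i_{jk}x^k_\alpha+\dfrac{g^{ik}}2\dfrac{\partial g_{jk}}{\partial t^\alpha}+\dfrac{g^{ik}}4h_{\alpha\gamma}U^{(\gamma)}_{(k)j},&p\geq2,\end{cases}$$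 where for $p=1$: $\mathcal{G}^i=\frac{g^{ik}}4\left[\frac{\partial^2L}{\partial x^j\partial y^k}y^j-\frac{\partial L}{\partial x^k}+\frac{\partial^2L}{\partial t\partial y^k}+\frac{\partial L}{\partial y^k}H^1_{11}+2h^{11}H^1_{11}g_{kl}y^l\right]$. Adapted basis: $\frac{\delta}{\delta t^\alpha}=\frac{\partial}{\partial t^\alpha}-M^{(j)}_{(\beta)\alpha}\frac{\partial}{\partial x^j_\beta}$, $\frac{\delta}{\delta x^i}=\frac{\partial}{\partial x^i}-N^{(j)}_{(\beta)i}\frac{\partial}{\partial x^j_\beta}$, $\frac{\partial}{\partial x^i_\alpha}$. The Cartan canonical connection $C\Gamma=(H^\gamma_{\alpha\beta},G^k_{j\gamma},L^i_{jk},C^{i(\gamma)}_{j(k)})$ is the linear connection $\nabla$ on $E$ given by $$\nabla_{\frac{\delta}{\delta t^\gamma}}\tfrac{\delta}{\delta t^\beta}=H^\alpha_{\beta\gamma}\tfrac{\delta}{\delta t^\alpha},\quad \nabla_{\frac{\delta}{\delta t^\gamma}}\tfrac{\delta}{\delta x^i}=G^k_{i\gamma}\tfrac{\delta}{\delta x^k},\quad \nabla_{\frac{\delta}{\delta t^\gamma}}\tfrac{\partial}{\partial x^i_\beta}=(\delta^\beta_\alpha G^k_{i\gamma}-\delta^k_iH^\beta_{\alpha\gamma})\tfrac{\partial}{\partial x^k_\alpha},$$ $$\nabla_{\frac{\delta}{\delta x^j}}\tfrac{\delta}{\delta t^\beta}=0,\quad \nabla_{\frac{\delta}{\delta x^j}}\tfrac{\delta}{\delta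 x^i}=L^k_{ij}\tfrac{\delta}{\delta x^k},\quad \nabla_{\frac{\delta}{\delta x^j}}\tfrac{\partial}{\partial x^i_\beta}=L^k_{ij}\tfrac{\partial}{\partial x^k_\beta},$$ $$\nabla_{\frac{\partial}{\partial x^j_\gamma}}\tfrac{\delta}{\delta t^\beta}=0,\quad \nabla_{\frac{\partial}{\partial x^j_\gamma}}\tfrac{\delta}{\delta x^i}=C^{k(\gamma)}_{i(j)}\tfrac{\delta}{\delta x^k},\quad \nabla_{\frac{\partial}{\partial x^j_\gamma}}\tfrac{\partial}{\partial x^i_\beta}=C^{k(\gamma)}_{i(j)}\tfrac{\partial}{\partial x^k_\beta},$$ with $$G^k_{j\gamma}=\frac{g^{ki}}2\frac{\delta g_{ij}}{\delta t^\gamma},\quad L^i_{jk}=\frac{g^{im}}2\left(\frac{\delta g_{jm}}{\delta x^k}+\frac{\delta g_{km}}{\delta x^j}-\frac{\delta g_{jk}}{\delta x^m}\right),\quad C^{i(\gamma)}_{j(k)}=\frac{g^{im}}2\left(\frac{\partial g_{jm}}{\partial x^k_\gamma}+\frac{\partial g_{km}}{\partial x^j_\gamma}-\frac{\partial g_{jk}}{\partial x^m_\gamma}\right).$$ Curvature components: with $\mathbf{R}(X,Y)Z=\nabla_X\nabla_YZ-\nabla_Y\nabla_XZ-\nabla_{[X,Y]}Z$, the components are the coefficients in $$\mathbf{R}\left(\tfrac{\delta}{\delta t^\gamma},\tfrac{\delta}{\delta t^\beta}\right)\tfrac{\delta}{\delta t^\eta}=H^\alpha_{\eta\beta\gamma}\tfrac{\delta}{\delta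 t^\alpha},\quad \mathbf{R}\left(\tfrac{\delta}{\delta t^\gamma},\tfrac{\delta}{\delta t^\beta}\right)\tfrac{\delta}{\delta x^i}=R^l_{i\beta\gamma}\tfrac{\delta}{\delta x^l},\quad \mathbf{R}\left(\tfrac{\delta}{\delta t^\gamma},\tfrac{\delta}{\delta t^\beta}\right)\tfrac{\partial}{\partial x^i_\alpha}=R^{(l)(\alpha)}_{(\eta)(i)\beta\gamma}\tfrac{\partial}{\partial x^l_\eta},$$ and likewise, acting on $\frac{\delta}{\delta x^i}$ and on $\frac{\partial}{\partial x^i_\alpha}$ respectively, $\mathbf{R}\left(\frac{\delta}{\delta x^k},\frac{\delta}{\delta t^\beta}\right)$ has components $R^l_{i\beta k}$ and $R^{(l)(\alpha)}_{(\eta)(i)\beta k}$; $\mathbf{R}\left(\frac{\delta}{\delta x^k},\frac{\delta}{\delta x^j}\right)$ has components $R^l_{ijk}$ and $R^{(l)(\alpha)}_{(\eta)(i)jk}$; $\mathbf{R}\left(\frac{\partial}{\partial x^k_\gamma},\frac{\delta}{\delta t^\beta}\right)$ has components $P^{l\;(\gamma)}_{i\beta(k)}$ and $P^{(l)(\alpha)\;(\gamma)}_{(\eta)(i)\beta(k)}$; $\mathbf{R}\left(\frac{\partial}{\partial x^k_\gamma},\frac{\delta}{\delta x^j}\right)$ has components $P^{l\;(\gamma)}_{ij(k)}$ and $P^{(l)(\alpha)\;(\gamma)}_{(\eta)(i)j(k)}$; $\mathbf{R}\left(\frac{\partial}{\partial x^k_\gamma},\frac{\partial}{\partial x^j_\beta}\right)$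 has components $S^{l(\beta)(\gamma)}_{i(j)(k)}$ and $S^{(l)(\alpha)(\beta)(\gamma)}_{(\eta)(i)(j)(k)}$. For $p=1$ the torsion components occurring in (i) are $$R^{(m)}_{(1)1k}=\frac{\delta M^{(m)}_{(1)1}}{\delta x^k}-\frac{\delta N^{(m)}_{(1)k}}{\delta t},\quad R^{(m)}_{(1)jk}=\frac{\delta N^{(m)}_{(1)j}}{\delta x^k}-\frac{\delta N^{(m)}_{(1)k}}{\delta x^j},\quad P^{(m)\;(1)}_{(1)1(k)}=-G^m_{k1},\quad P^{(m)\;(1)}_{(1)j(k)}=\frac{\partial N^{(m)}_{(1)j}}{\partial y^k}-L^m_{kj},$$ and the $T$-horizontal and $M$-horizontal covariant derivatives of $C$ are $$C^{l(1)}_{i(k)/1}=\frac{\delta C^{l(1)}_{i(k)}}{\delta t}+C^{m(1)}_{i(k)}G^l_{m1}-C^{l(1)}_{m(k)}G^m_{i1}-C^{l(1)}_{i(m)}G^m_{k1}+C^{l(1)}_{i(k)}H^1_{11},$$ $$C^{l(1)}_{i(k)|j}=\frac{\delta C^{l(1)}_{i(k)}}{\delta x^j}+C^{m(1)}_{i(k)}L^l_{mj}-C^{l(1)}_{m(k)}L^m_{ij}-C^{l(1)}_{i(m)}L^m_{kj}.$$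
   Formalization: In (ii) the vertical component is proved with a minus sign, δ^α_η R^l_{iβγ} − δ^l_i H^α_{ηβγ}; the printed plus sign is false under the stated conventions, e.g. for T=S² with the round metric, M=ℝ, L=h^{αβ}x_αx_β. *)

(* Defs.v *)
From HB Require Import structures.
From mathcomp Require Import all_boot all_order all_algebra.
From mathcomp Require Import all_classical all_reals all_analysis.

Set Implicit Arguments.
Unset Strict Implicit.
Unset Printing Implicit Defensive.

Import Order.TTheory GRing.Theory Num.Theory numFieldNormedType.Exports.

Local Open Scope classical_set_scope.
Local Open Scope ring_scope.

(* C^k and C^oo on D (used with D open and V finite-dimensional): all iterated
   directional derivatives of order <= k exist and are continuous on D. *)
Fixpoint Ck (R : realType) (V W : normedModType R) (k : nat) (D : set V)
    (f : V -> W) : Prop :=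
  (forall x, D x -> {for x, continuous f}) /\
  match k with
  | 0 => True
  | k'.+1 => forall v : V,
      (forall x, D x -> derivable f x v) /\ Ck k' D (fun x => 'D_v f x : W)
  end.

Definition smooth (R : realType) (V W : normedModType R) (D : set V)
    (f : V -> W) : Prop :=
  forall k, Ck k D f.

(* jac f x i j is the partial derivative of the i-th component of f along the
   j-th coordinate. *)
Definition jac (R : realType) (d : nat) (f : 'rV[R]_d -> 'rV[R]_d)
    (x : 'rV[R]_d) : 'M[R]_d :=
  \matrix_(i, j) ('D_(delta_mx 0 j) (fun y => f y 0 i : R) x : R).

(* Smooth manifolds of dimension d, given by an atlas; chart_inv a is the
   inverse of chart a on its range. *)
Record manifold (R : realType) (T : topologicalType) (d : nat) := Manifold {
  chart_index : Type;
  chart_dom : chart_index -> set T;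
  chart : chart_index -> T -> 'rV[R]_d;
  chart_inv : chart_index -> 'rV[R]_d -> T;
  manifold_hausdorff : hausdorff_space T;
  manifold_countable : @second_countable T;
  chart_cover : forall t, exists a, chart_dom a t;
  chart_dom_open : forall a, open (chart_dom a);
  chart_range_open : forall a, open (chart a @` chart_dom a);
  chartK : forall a t, chart_dom a t -> chart_inv a (chart a t) = t;
  chart_continuous :
    forall a t, chart_dom a t -> {for t, continuous (chart a)};
  chart_inv_continuous :
    forall a x, (chart a @` chart_dom a) x -> {for x, continuous (chart_inv a)};
  chart_trans_smooth : forall a b,
    smooth (chart a @` (chart_dom a `&` chart_dom b)) (chart b \o chart_inv a)
}.

Section Atlas.
Variables (R : realType) (T : topologicalType) (d : nat).
Variable (X : manifold R T d).

Definition chart_range (a : chart_index X) : set 'rV[R]_d :=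
  chart a @` chart_dom a.

Definition overlap (a b : chart_index X) : set 'rV[R]_d :=
  chart a @` (chart_dom a `&` chart_dom b).

Definition trans (a b : chart_index X) : 'rV[R]_d -> 'rV[R]_d :=
  chart b \o chart_inv a.

End Atlas.

Section Coordinates.
Variables (R : realType) (p n : nat).

(* Local coordinates z = (t, x, A) of the jet bundle: t^alpha = z.1.1 0 alpha,
   x^i = z.1.2 0 i and x^i_alpha = z.2 i alpha. *)
Definition jet : normedModType R := ('rV[R]_p * 'rV[R]_n * 'M[R]_(n, p))%type.

(* Indices of the 1 + 1 + 1 blocks of a frame of the tangent bundle of J^1. *)
Inductive frame_index :=
  | tI of 'I_p
  | xI of 'I_n
  | vI of 'I_n & 'I_p.

Definition is_t (A : frame_index) : bool := if A is tI _ then true else false.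
Definition is_v (A : frame_index) : bool := if A is vI _ _ then true else false.

Definition same_block (A B : frame_index) : bool :=
  (is_t A == is_t B) && (is_v A == is_v B).

Definition sum_frame (f : frame_index -> R) : R :=
  \sum_al f (tI al) + \sum_i f (xI i) + \sum_i \sum_al f (vI i al).

Definition coord_vector (A : frame_index) : jet :=
  match A with
  | tI al => (delta_mx 0 al, 0, 0)
  | xI i => (0, delta_mx 0 i, 0)
  | vI i al => (0, 0, delta_mx i al)
  end.

Definition pd (A : frame_index) (f : jet -> R) (z : jet) : R :=
  'D_(coord_vector A) f z.

(* X A is the component of X along the coordinate vector field number A. *)
Definition vector_field := frame_index -> jet -> R.

Definition act (X : vector_field) (f : jet -> R) (z : jet) : R :=
  sum_frame (fun A => X A z * pd A f z).

Definition lie_bracket (X Y : vector_field) : vector_field :=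
  fun A z => act X (Y A) z - act Y (X A) z.

(* h is the metric of T pulled back to J^1, g the vertical metric and
   N i al j the coefficient N^(i)_(al)j. *)
Record connection_data := ConnectionData {
  cd_h : jet -> 'M[R]_p;
  cd_g : jet -> 'M[R]_n;
  cd_N : 'I_n -> 'I_p -> 'I_n -> jet -> R
}.

Section MetricSymbols.
Variables (h : jet -> 'M[R]_p) (g : jet -> 'M[R]_n).

Definition invm (d : nat) (m : jet -> 'M[R]_d) (i j : 'I_d) (z : jet) : R :=
  invmx (m z) i j.

(* chrisT ga al be = H^ga_(al be) *)
Definition chrisT (ga al be : 'I_p) (z : jet) : R :=
  \sum_mu invm h ga mu z / 2%:R *
    (pd (tI al) (fun w => h w mu be) z + pd (tI be) (fun w => h w mu al) z
     - pd (tI mu) (fun w => h w al be) z).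

(* chrisM l j k = Gamma^l_(jk) *)
Definition chrisM (l j k : 'I_n) (z : jet) : R :=
  \sum_i invm g l i z / 2%:R *
    (pd (xI k) (fun w => g w i j) z + pd (xI j) (fun w => g w i k) z
     - pd (xI i) (fun w => g w j k) z).

(* The temporal coefficients M^(i)_(al)be. *)
Definition temporal (i : 'I_n) (al be : 'I_p) (z : jet) : R :=
  - \sum_ga chrisT ga al be z * z.2 i ga.

(* The spray G^i of the case p = 1; o is the only element of 'I_p. *)
Definition spray (L : jet -> R) (o : 'I_p) (i : 'I_n) (z : jet) : R :=
  \sum_k invm g i k z / 4%:R *
    (\sum_j pd (xI j) (pd (vI k o) L) z * z.2 j o
     - pd (xI k) L z
     + pd (tI o) (pd (vI k o) L) z
     + pd (vI k o) L z * chrisT o o o z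
     + 2%:R * invm h o o z * chrisT o o o z * \sum_l g z k l * z.2 l o).

Definition spatial1 (L : jet -> R) (i : 'I_n) (al : 'I_p) (j : 'I_n)
    (z : jet) : R :=
  h z al al * pd (vI j al) (spray L al i) z.

(* U z i al = U^(al)_(i), and curlU U al i j = U^(al)_(i)j. *)
Definition curlU (U : jet -> 'M[R]_(n, p)) (al : 'I_p) (i j : 'I_n)
    (z : jet) : R :=
  pd (xI j) (fun w => U w i al) z - pd (xI i) (fun w => U w j al) z.

Definition spatial2 (U : jet -> 'M[R]_(n, p)) (i : 'I_n) (al : 'I_p)
    (j : 'I_n) (z : jet) : R :=
  \sum_k chrisM i j k z * z.2 k al
  + \sum_k invm g i k z / 2%:R * pd (tI al) (fun w => g w j k) z
  + \sum_k invm g i k z / 4%:R * \sum_ga h z al ga * curlU U ga k j z.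

End MetricSymbols.

Section CartanConnection.
Variable (S : connection_data).
Let h := cd_h S.
Let g := cd_g S.

Definition cH := chrisT h.
Definition cM := temporal h.
Definition cN := cd_N S.

(* The adapted basis delta/delta t^al, delta/delta x^i, d/dx^i_al. *)
Definition adapted (A : frame_index) : vector_field := fun B z =>
  match A, B with
  | tI al, tI be => (be == al)%:R
  | tI al, vI j be => - cM j be al z
  | xI i, xI j => (j == i)%:R
  | xI i, vI j be => - cN j be i z
  | vI i al, vI j be => ((j == i) && (be == al))%:R
  | _, _ => 0
  end.

Definition delta (A : frame_index) (f : jet -> R) : jet -> R :=
  act (adapted A) f.

(* coef A Y is the component of Y along adapted A, so that
   Y = \sum_A (coef A Y) (adapted A). *)
Definition coef (A : frame_index) (Y : vector_field) (z : jet) : R :=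
  match A with
  | tI al => Y (tI al) z
  | xI i => Y (xI i) z
  | vI i al => Y (vI i al) z + \sum_be cM i al be z * Y (tI be) z
               + \sum_j cN i al j z * Y (xI j) z
  end.

(* cG k j ga = G^k_(j ga), cL i j k = L^i_(jk), cC i j k ga = C^i(ga)_j(k) *)
Definition cG (k j : 'I_n) (ga : 'I_p) (z : jet) : R :=
  \sum_i invm g k i z / 2%:R * delta (tI ga) (fun w => g w i j) z.

Definition cL (i j k : 'I_n) (z : jet) : R :=
  \sum_m invm g i m z / 2%:R *
    (delta (xI k) (fun w => g w j m) z + delta (xI j) (fun w => g w k m) z
     - delta (xI m) (fun w => g w j k) z).

Definition cC (i j k : 'I_n) (ga : 'I_p) (z : jet) : R :=
  \sum_m invm g i m z / 2%:R *
    (pd (vI k ga) (fun w => g w j m) z + pd (vI j ga) (fun w => g w k m) z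
     - pd (vI m ga) (fun w => g w j k) z).

(* conn A B D is the component along adapted D of the covariant derivative of
   adapted B in the direction adapted A. In the (tI, vI, vI) entry the index be
   of d/dx^i_be is acted on by the dual of the connection cH; hence the temporal
   curvature enters the vertical curvature components with a minus sign. *)
Definition conn (A B D : frame_index) (z : jet) : R :=
  match A, B, D with
  | tI ga, tI be, tI al => cH al be ga z
  | tI ga, xI i, xI k => cG k i ga z
  | tI ga, vI i be, vI k al =>
      (be == al)%:R * cG k i ga z - (k == i)%:R * cH be al ga z
  | xI j, xI i, xI k => cL k i j z
  | xI j, vI i be, vI k al => (al == be)%:R * cL k i j z
  | vI j ga, xI i, xI k => cC k i j ga z
  | vI j ga, vI i be, vI k al => (al == be)%:R * cC k i j ga z
  | _, _, _ => 0
  end.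

(* Covariant derivative of the linear connection with coefficients conn: for
   Y = \sum_B Y^B e_B, it is \sum_B X(Y^B) e_B + \sum_(A, B) X^A Y^B nabla_(e_A)
   e_B, where e is the adapted basis. *)
Definition nabla (X Y : vector_field) : vector_field := fun E z =>
  sum_frame (fun D =>
    (act X (coef D Y) z
     + sum_frame (fun A => sum_frame (fun B =>
         coef A X z * coef B Y z * conn A B D z)))
    * adapted D E z).

Definition curvature (X Y Z : vector_field) : vector_field := fun E z =>
  nabla X (nabla Y Z) E z - nabla Y (nabla X Z) E z
  - nabla (lie_bracket X Y) Z E z.

(* The component along adapted D of R(adapted A, adapted B) adapted C. *)
Definition curv (A B C D : frame_index) (z : jet) : R :=
  coef D (curvature (adapted A) (adapted B) (adapted C)) z.

(* Torsion components and covariant derivatives of C for p = 1: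
   torRt m k = R^(m)_(1)1k, torRx m j k = R^(m)_(1)jk,
   torPt m k = P^(m)(1)_(1)1(k), torPx m j k = P^(m)(1)_(1)j(k),
   covCt l i k = C^l(1)_i(k)/1, covCx l i k j = C^l(1)_i(k)|j. *)
Section OneTime.
Variable (o : 'I_p).

Definition torRt (m k : 'I_n) (z : jet) : R :=
  delta (xI k) (cM m o o) z - delta (tI o) (cN m o k) z.

Definition torRx (m j k : 'I_n) (z : jet) : R :=
  delta (xI k) (cN m o j) z - delta (xI j) (cN m o k) z.

Definition torPt (m k : 'I_n) (z : jet) : R := - cG m k o z.

Definition torPx (m j k : 'I_n) (z : jet) : R :=
  pd (vI k o) (cN m o j) z - cL m k j z.

Definition covCt (l i k : 'I_n) (z : jet) : R :=
  delta (tI o) (cC l i k o) z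
  + \sum_m cC m i k o z * cG l m o z
  - \sum_m cC l m k o z * cG m i o z
  - \sum_m cC l i m o z * cG m k o z
  + cC l i k o z * cH o o o z.

Definition covCx (l i k j : 'I_n) (z : jet) : R :=
  delta (xI j) (cC l i k o) z
  + \sum_m cC m i k o z * cL l m j z
  - \sum_m cC l m k o z * cL m i j z
  - \sum_m cC l i m o z * cL m k j z.

End OneTime.

End CartanConnection.

End Coordinates.

Arguments tI {p n} _.
Arguments xI {p n} _.
Arguments vI {p n} _ _.

(* S is congruent to diag(1, .., 1, -1, .., -1) with r entries equal to 1. *)
Definition has_signature (R : realType) (d r : nat) (S : 'M[R]_d) : Prop :=
  exists2 Q : 'M[R]_d, Q \in unitmx &
    Q^T *m S *m Q = diag_mx (\row_(i < d) (if (i < r)%N then 1 else -1)).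

Section LagrangeSpace.
Variables (R : realType) (p n : nat) (T M : topologicalType).
Variables (XT : manifold R T p) (XM : manifold R M n).

Definition semi_riemannian
    (h : chart_index XT -> 'rV[R]_p -> 'M[R]_p) : Prop :=
  [/\ forall a, smooth (chart_range a) (h a),
      forall a t, chart_range a t -> (h a t)^T = h a t,
      exists r, forall a t, chart_range a t -> has_signature r (h a t)
    & forall a a' t, overlap a a' t ->
        h a t = (jac (trans a a') t)^T *m h a' (trans a a' t)
                *m jac (trans a a') t].

Definition jet_range (a : chart_index XT) (b : chart_index XM) :
    set (jet R p n) :=
  [set z | chart_range a z.1.1 /\ chart_range b z.1.2].

Definition jet_overlap (a a' : chart_index XT) (b b' : chart_index XM) :
    set (jet R p n) :=
  [set z | overlap a a' z.1.1 /\ overlap b b' z.1.2].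

Definition jet_trans (a a' : chart_index XT) (b b' : chart_index XM)
    (z : jet R p n) : jet R p n :=
  let t' := trans a a' z.1.1 in
  (t', trans b b' z.1.2, jac (trans b b') z.1.2 *m z.2 *m jac (trans a' a) t').

(* A d-tensor is a family of smooth local functions, one for each pair of
   charts of T and M, with the following transformation rules. *)
Definition d_scalar
    (f : chart_index XT -> chart_index XM -> jet R p n -> R) : Prop :=
  (forall a b, smooth (jet_range a b) (f a b)) /\
  (forall a a' b b' z, jet_overlap a a' b b' z ->
     f a b z = f a' b' (jet_trans a a' b b' z)).

Definition d_tensor_g
    (g : chart_index XT -> chart_index XM -> jet R p n -> 'M[R]_n) : Prop :=
  (forall a b, smooth (jet_range a b) (g a b)) /\
  (forall a a' b b' z, jet_overlap a a' b b' z ->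
     g a b z = (jac (trans b b') z.1.2)^T *m g a' b' (jet_trans a a' b b' z)
               *m jac (trans b b') z.1.2).

Definition d_tensor_U
    (U : chart_index XT -> chart_index XM -> jet R p n -> 'M[R]_(n, p)) : Prop :=
  (forall a b, smooth (jet_range a b) (U a b)) /\
  (forall a a' b b' z, jet_overlap a a' b b' z ->
     U a b z = (jac (trans b b') z.1.2)^T *m U a' b' (jet_trans a a' b b' z)
               *m (jac (trans a' a) (trans a a' z.1.1))^T).

(* (J^1(T, M), L) is a metrical multi-time Lagrange space with vertical metric
   g. *)
Definition lagrange_space
    (h : chart_index XT -> 'rV[R]_p -> 'M[R]_p)
    (L : chart_index XT -> chart_index XM -> jet R p n -> R)
    (g : chart_index XT -> chart_index XM -> jet R p n -> 'M[R]_n) : Prop :=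
  [/\ d_scalar L,
      d_tensor_g g,
      forall a b z, jet_range a b z ->
        (g a b z)^T = g a b z /\ \rank (g a b z) = n,
      exists r, forall a b z, jet_range a b z -> has_signature r (g a b z)
    & forall a b z, jet_range a b z -> forall i j al be,
        2%:R^-1 * pd (vI i al) (pd (vI j be) (L a b)) z
        = invmx (h a z.1.1) al be * g a b z i j].

(* f depends only on (t, x). *)
Definition fibre_constant (Y : Type)
    (f : chart_index XT -> chart_index XM -> jet R p n -> Y) : Prop :=
  forall a b z z', jet_range a b z -> z'.1 = z.1 -> f a b z' = f a b z.

(* The form of L forced by Kronecker h-regularity when p >= 2. *)
Definition polynomial_form
    (h : chart_index XT -> 'rV[R]_p -> 'M[R]_p)
    (L : chart_index XT -> chart_index XM -> jet R p n -> R)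
    (g : chart_index XT -> chart_index XM -> jet R p n -> 'M[R]_n)
    (U : chart_index XT -> chart_index XM -> jet R p n -> 'M[R]_(n, p))
    (F : chart_index XT -> chart_index XM -> jet R p n -> R) : Prop :=
  [/\ [/\ fibre_constant g, fibre_constant U & fibre_constant F],
      d_tensor_U U,
      d_scalar F
    & forall a b z, jet_range a b z ->
        L a b z =
          \sum_al \sum_be \sum_i \sum_j
            invmx (h a z.1.1) al be * g a b z i j * z.2 i al * z.2 j be
          + \sum_i \sum_al U a b z i al * z.2 i al
          + F a b z].

End LagrangeSpace.

Section CartanData.
Variables (R : realType) (p n : nat).

Definition lift_h (h : 'rV[R]_p -> 'M[R]_p) (z : jet R p n) : 'M[R]_p :=
  h z.1.1.

(* The canonical nonlinear connection for p = 1 and for p >= 2. *)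
Definition cartan1 (h : 'rV[R]_p -> 'M[R]_p) (L : jet R p n -> R)
    (g : jet R p n -> 'M[R]_n) : connection_data R p n :=
  ConnectionData (lift_h h) g (spatial1 (lift_h h) g L).

Definition cartan2 (h : 'rV[R]_p -> 'M[R]_p) (U : jet R p n -> 'M[R]_(n, p))
    (g : jet R p n -> 'M[R]_n) : connection_data R p n :=
  ConnectionData (lift_h h) g (spatial2 (lift_h h) g U).

End CartanData.

(* Main.v *)
(* The adapted frame e is anholonomic only in the vertical directions, so the
   component of R(e_A, e_B) e_C along e_D is
     e_A(Gamma_BC^D) - e_B(Gamma_AC^D) + Gamma_BC^E Gamma_AE^D
       - Gamma_AC^E Gamma_BE^D - [e_A, e_B]^F Gamma_FC^D
   with F vertical, where Gamma are the coefficients of the Cartan connection.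
   For p = 1 the bracket coefficients are, up to sign, the torsions. For p >= 2
   the symmetry of the third vertical derivatives of L forces g to be constant
   along the fibres of the jet bundle; then C vanishes, L^i_jk reduces to
   Gamma^i_jk, every connection coefficient depends on (t, x) only, and L is
   recovered by Taylor expansion along the fibres from the zero section. *)

Require Import Defs.
From HB Require Import structures.
From mathcomp Require Import all_boot all_order all_algebra.
From mathcomp Require Import all_classical all_reals all_analysis.

From mathcomp Require Import ring lra.

Set Implicit Arguments.
Unset Strict Implicit.
Unset Printing Implicit Defensive.

Import Order.TTheory GRing.Theory Num.Theory numFieldNormedType.Exports.

Local Open Scope classical_set_scope.
Local Open Scope ring_scope.

(** * Directional derivatives *)

(** Two features of the setting shape the argument. Smoothness means that iterated directional
    derivatives exist and are continuous, so linearity of the derivative in its direction and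
    symmetry of mixed derivatives have to be drawn from the mean value theorem. Moreover a
    derivative is the limit of a difference quotient, made total by a default value, so the sum and
    product rules are conditional on derivability. The curvature computation mostly avoids these
    rules: the adapted fields have constant components in their own frame, so each derivation meets
    a single connection coefficient, and functions are exchanged under a derivative by comparing
    difference quotients along the line concerned. Genuine rules enter twice. For p = 1 the bracket
    of d/dy^k and delta/delta t differentiates M = - H y, a product with one factor constant along
    the line. For p >= 2 the purely temporal curvature of the vertical block differentiates a
    difference of G- and H-coefficients, whose derivability comes from the smoothness and
    invertibility of the two metrics. *)

Section DirectionalDerivatives.
Variables (R : realType) (W : normedModType R).

(** Derivative and derivability depend only on the filter of difference quotients at 0. Spaces,
    points and directions may differ on the two sides, so the same fact serves restriction to a
    line, translation, linear substitution and addition of a function constant along the line. *)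
Lemma near_eq_diff_quotient (V V' : normedModType R) (f : V -> W)
    (f' : V' -> W) x v x' v' :
    (\forall s \near (0 : R),
      f (s *: v + x) - f x = f' (s *: v' + x') - f' x') ->
  'D_v f x = 'D_v' f' x' /\ (derivable f x v -> derivable f' x' v').
Proof.
move=> ff'.
have E : (fun s : R => s^-1 *: ((f \o shift x) (s *: v) - f x)) @ 0^' =
         (fun s : R => s^-1 *: ((f' \o shift x') (s *: v') - f' x')) @ 0^'.
  rewrite eqEsubset; split; apply/near_eq_cvg/cvg_within; near=> s;
    by rewrite /= (near ff' s).
by rewrite /derive /derivable E.
Unshelve. all: by end_near. Qed.

Lemma eq_diff_quotient (V V' : normedModType R) (f : V -> W)
    (f' : V' -> W) x v x' v' :
    (forall s : R, f (s *: v + x) - f x = f' (s *: v' + x') - f' x') ->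
  'D_v f x = 'D_v' f' x' /\ (derivable f x v -> derivable f' x' v').
Proof.
by move=> ff'; apply: near_eq_diff_quotient; near=> s; exact: ff'.
Unshelve. all: by end_near. Qed.

Lemma eq_derive_line (V V' : normedModType R) (f : V -> W)
    (f' : V' -> W) x v x' v' :
  (forall s : R, f (s *: v + x) = f' (s *: v' + x')) -> 'D_v f x = 'D_v' f' x'.
Proof.
move=> ff'; apply: (eq_diff_quotient _).1; move=> s.
by rewrite ff'; have := ff' 0; rewrite !scale0r !add0r => ->.
Qed.

Lemma eq_derivable_line (V V' : normedModType R) (f : V -> W)
    (f' : V' -> W) x v x' v' :
    (forall s : R, f (s *: v + x) = f' (s *: v' + x')) ->
  derivable f x v -> derivable f' x' v'.
Proof.
move=> ff'; apply: (eq_diff_quotient _).2; move=> s.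
by rewrite ff'; have := ff' 0; rewrite !scale0r !add0r => ->.
Qed.

Lemma derive_const_line (V : normedModType R) (f : V -> W) x v :
  (forall s : R, f (s *: v + x) = f x) -> 'D_v f x = 0.
Proof.
move=> fc; rewrite (@eq_derive_line V V f (cst (f x)) x v 0 0) ?derive_cst//.
Qed.

End DirectionalDerivatives.

Section ScalarDerivatives.
Variables (R : realType) (V : normedModType R).
Implicit Types (f c : V -> R) (x v : V).

(* The limit of a divergent difference quotient is the default value 0; hence
   derivation commutes with opposites unconditionally, and the curvature
   identities below need no regularity of the nonlinear connection. *)
Lemma derive_nonderivable f x v : ~ derivable f x v -> 'D_v f x = 0.
Proof.
move=> nf; rewrite /derive /lim /lim_in xgetPN// => l fl.
by apply: nf; apply/cvg_ex; exists l.
Qed.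

Lemma deriveN_any f x v : 'D_v (fun y => - f y) x = - 'D_v f x.
Proof.
have [df|ndf] := pselect (derivable f x v); first by rewrite deriveN.
rewrite (derive_nonderivable ndf) oppr0.
apply: derive_nonderivable => dNf; apply: ndf.
apply: eq_derivable_line (derivableN dNf) => s.
by rewrite [LHS]opprK.
Qed.

Lemma deriveD_const f c x v : (forall s : R, c (s *: v + x) = c x) ->
  'D_v (fun y => f y + c y) x = 'D_v f x.
Proof.
move=> cc; apply: (eq_diff_quotient _).1; move=> s.
by rewrite cc opprD addrACA subrr addr0.
Qed.

Lemma deriveM_const f c x v : derivable f x v ->
  (forall s : R, c (s *: v + x) = c x) ->
  'D_v (fun y => c y * f y) x = c x * 'D_v f x.
Proof.
move=> df cc; rewrite -[RHS]/(c x *: 'D_v f x) -deriveZ//.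
by apply: eq_derive_line => s; rewrite cc.
Qed.

Lemma derive_affine f x v (c : R) :
  (forall s : R, f (s *: v + x) = s * c + f x) -> is_derive x v f c.
Proof.
move=> fc.
have near_c : \forall h \near 0^', h^-1 *: ((f \o shift x) (h *: v) - f x) = c.
  near=> h; rewrite /= fc addrK [LHS]mulrA mulVf ?mul1r//.
  by near: h; exact: nbhs_dnbhs_neq.
by apply: DeriveDef; [exact: is_cvg_near_cst near_c|exact: lim_near_cst near_c].
Unshelve. all: by end_near. Qed.

End ScalarDerivatives.

Lemma near0_and (R : realType) (P Q : R -> Prop) :
  (\forall s \near (0 : R), P s) -> (\forall s \near (0 : R), Q s) ->
  \forall s \near (0 : R), P s /\ Q s.
Proof. by move=> nP nQ; near=> s; split; near: s. Unshelve. all: by end_near. Qed.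

(** Provides the nonzero step by which the mean value identities are divided. *)
Lemma near0_ex (R : realType) (P : R -> Prop) :
  (\forall s \near (0 : R), P s) -> exists2 s : R, s != 0 & P s.
Proof.
move=> nP; near (0 : R)^' => s; exists s; near: s; first exact: nbhs_dnbhs_neq.
exact: nbhs_dnbhs.
Unshelve. all: by end_near. Qed.

Section OpenDomains.
Variables (R : realType) (V : normedModType R).
Implicit Types (D : set V) (u v x : V).

(** The small parallelogram spanned by s u and s v holds every intermediate point produced by the
    mean value theorem in the two arguments below. *)
Lemma near_box D x u v : nbhs x D -> \forall s \near (0 : R),
  forall a b : R, 0 <= a <= 1 -> 0 <= b <= 1 ->
    D (s *: (a *: u + b *: v) + x).
Proof.
(* The added 1 keeps [c] positive when u = v = 0. *)
move=> /nbhs_normP[e /= e0 De]; set c := `|u| + `|v| + 1.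
have c0 : 0 < c by rewrite ltr_pwDr// addr_ge0.
apply/nbhs_normP; exists (e / c) => /=; first by rewrite divr_gt0.
move=> s; rewrite /= sub0r normrN => sc a b /andP[a0 a1] /andP[b0 b1].
apply: De; rewrite /= opprD addrCA subrr addr0 normrN normrZ.
apply: (@le_lt_trans _ _ (`|s| * c)); last by rewrite -ltr_pdivlMr.
rewrite ler_wpM2l// (le_trans (ler_normD _ _))// !normrZ.
rewrite (ger0_norm a0) (ger0_norm b0).
rewrite -[leLHS]addr0 lerD// lerD// ler_piMl//.
Qed.

Lemma near_box_cvg (k : V -> R) x u v (e : R) :
    {for x, continuous k} -> 0 < e -> \forall s \near (0 : R),
  forall a b : R, 0 <= a <= 1 -> 0 <= b <= 1 ->
    `|k x - k (s *: (a *: u + b *: v) + x)| < e.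
Proof.
move=> /cvgrPdist_lt kx e0.
by apply: (@near_box (fun y => `|k x - k y| < e)); exact: kx.
Qed.

Lemma open_near_box D x u v : open D -> D x -> \forall s \near (0 : R),
  forall a b : R, 0 <= a <= 1 -> 0 <= b <= 1 ->
    D (s *: (a *: u + b *: v) + x).
Proof. by move=> oD Dx; apply: near_box; exact: open_nbhs_nbhs. Qed.

Lemma near_line D x v : nbhs x D -> \forall s \near (0 : R), D (s *: v + x).
Proof.
move=> /(near_box v 0); apply: filterS => s /(_ 1 0).
by rewrite scale1r scale0r addr0 !lexx ler01; apply.
Qed.

Lemma open_near_line D x v : open D -> D x ->
  \forall s \near (0 : R), D (s *: v + x).
Proof. by move=> oD Dx; apply: near_line; exact: open_nbhs_nbhs. Qed.

Lemma eq_derive_open (W : normedModType R) D (f f' : V -> W) x v :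
    open D -> D x -> (forall y, D y -> f y = f' y) ->
  'D_v f x = 'D_v f' x.
Proof.
move=> oD Dx ff'; apply: near_eq_derive; near=> y; apply: ff'; near: y.
exact: open_nbhs_nbhs.
Unshelve. all: by end_near. Qed.

Lemma eq_derivable_open (W : normedModType R) D (f f' : V -> W) x v :
    open D -> D x -> (forall y, D y -> f y = f' y) ->
  derivable f x v -> derivable f' x v.
Proof.
move=> oD Dx ff'; apply: near_eq_derivable; near=> y; apply: ff'; near: y.
exact: open_nbhs_nbhs.
Unshelve. all: by end_near. Qed.

End OpenDomains.

(** Symmetry of a second difference in its two directions. *)
Lemma subrAC4 (R : realType) (a b c d : R) : a - b - (c - d) = a - c - (b - d).
Proof. ring. Qed.

Lemma dist_sum_le (R : realType) (e a a' b b' : R) :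
  `|a - a'| < e / 3%:R -> `|b - b'| < e / 3%:R ->
  forall c, `|c - (a' + b')| < e / 3%:R -> `|c - (a + b)| <= e.
Proof.
rewrite !ltr_norml => /andP[? ?] /andP[? ?] c; rewrite ltr_norml ler_norml.
by move=> /andP[? ?]; apply/andP; split; lra.
Qed.

Lemma dist_eq_le (R : realType) (e a a' b b' : R) :
  `|a - a'| < e / 2%:R -> `|b - b'| < e / 2%:R -> a' = b' -> `|a - b| <= e.
Proof.
move=> h1 h2 ab; move: h1 h2; rewrite ab !ltr_norml ler_norml.
by move=> /andP[? ?] /andP[? ?]; apply/andP; split; lra.
Qed.

(** * Mean value theorem, additivity in the direction, symmetry of second derivatives *)

Section MeanValue.
Variables (R : realType) (V : normedModType R).
Implicit Types (D : set V) (u v x : V) (f : V -> R).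

Lemma is_derive_line f x v (s : R) : derivable f (s *: v + x) v ->
  is_derive s (1 : R) (fun r : R => f (r *: v + x)) ('D_v f (s *: v + x)).
Proof.
move=> df; have e r : f (r *: v + (s *: v + x)) = f ((r *: (1 : R) + s) *: v + x).
  by rewrite scalerDl [r *: (1 : R)]mulr1 addrA.
apply: DeriveDef.
  exact: (@eq_derivable_line _ _ V R f (fun r => f (r *: v + x)) _ v s 1 e).
exact/esym/(@eq_derive_line _ _ V R f (fun r => f (r *: v + x)) _ v s 1 e).
Qed.

(** One-variable chain rule with the inner map r * c; it includes c = 0, where no change of
    parameter is possible. *)
Lemma is_derive_line_scaled f x v (c s : R) :
    derivable f (s *: (c *: v) + x) v ->
  is_derive s (1 : R) (fun r : R => f (r *: (c *: v) + x))
    (c * 'D_v f (s *: (c *: v) + x)).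
Proof.
rewrite scalerA => df.
have := @is_derive1_comp _ (fun r : R => f (r *: v + x)) (fun r => r * c) s _ c
  (is_derive_line df).
rewrite mulrC => H; have -> : (fun r : R => f (r *: (c *: v) + x)) =
    (fun r : R => f (r *: v + x)) \o (fun r => r * c).
  by apply/funext => r /=; rewrite scalerA.
apply: H; apply: derive_affine => t.
by rewrite mulrDl; congr (_ * _ + _); exact: mulr1.
Qed.

Lemma deriveZv f x v (c : R) : derivable f x v ->
  derivable f x (c *: v) /\ 'D_(c *: v) f x = c * 'D_v f x.
Proof.
move=> df.
have H : is_derive (0 : R) (1 : R) (fun r : R => f (r *: (c *: v) + x))
    (c * 'D_v f (0 *: (c *: v) + x)).
  by apply: is_derive_line_scaled; rewrite scale0r add0r.
have e r : f (r *: (c *: v) + x) = f ((r *: (1 : R) + 0) *: (c *: v) + x).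
  by rewrite addr0 [r *: (1 : R)]mulr1.
rewrite scale0r add0r in H; split.
  apply/derivable1P; exact: ex_derive.
rewrite (@eq_derive_line _ _ V R f (fun r => f (r *: (c *: v) + x)) x _ 0 1 e).
exact: derive_val.
Qed.

(** The intermediate point is parametrised by a in [0, 1] rather than by a number between 0 and s,
    which covers both signs of s and matches the points of [near_box]. *)
Lemma mean_value f x v (s : R) :
  (forall a : R, 0 <= a <= 1 -> derivable f (s *: (a *: v) + x) v) ->
  exists2 a : R, 0 <= a <= 1 &
    f (s *: v + x) - f x = s * 'D_v f (s *: (a *: v) + x).
Proof.
move=> df.
have H (a : R) : 0 <= a <= 1 ->
    is_derive a (1 : R) (fun r : R => f (r *: (s *: v) + x))
    (s * 'D_v f (a *: (s *: v) + x)).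
  by move=> /df; rewrite !scalerA mulrC -scalerA => d; exact: is_derive_line_scaled.
have [//|||a a01] := @MVT_segment R (fun r : R => f (r *: (s *: v) + x))
   (fun a => s * 'D_v f (a *: (s *: v) + x)) 0 1.
- by move=> a a01; apply: H; move: a01; rewrite in_itv/= => /andP[/ltW-> /ltW->].
- apply: derivable_within_continuous => a; rewrite in_itv/= => a01.
  by have [] := H _ a01.
- rewrite scale1r scale0r add0r subr0 mulr1 => e.
  exists a; first by rewrite in_itv in a01.
  by rewrite e !scalerA (mulrC s a).
Qed.

(** The increment of f along s (u + v) is the increment along s v from x followed by the one along s
    u. The mean value theorem turns the three increments into derivatives at nearby points, and
    continuity moves these to x. *)
Lemma derive_additive D f x u v : open D -> D x ->
    (forall w y, D y -> derivable f y w) ->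
    (forall w, {for x, continuous ('D_w f)}) ->
  'D_(u + v) f x = 'D_u f x + 'D_v f x.
Proof.
move=> oD Dx df cf; apply/eqP; rewrite -subr_eq0 -normr_le0.
apply/ler_addgt0Pl => e e0; rewrite addr0.
have e3 : 0 < e / 3%:R by rewrite divr_gt0.
have I0 : (0 : R) <= (0 : R) <= (1 : R) by rewrite lexx ler01.
have I1 : (0 : R) <= (1 : R) <= (1 : R) by rewrite lexx ler01.
have H := near0_and (near_box_cvg u v (cf u) e3)
  (near0_and (near_box_cvg u v (cf v) e3) (near_box_cvg u v (cf (u + v)) e3)).
have H' := near0_and (open_near_box u v oD Dx) H.
have [s s0 [sD [sU [sV sUV]]]] := near0_ex H'.
have [|a a01 Ea] := @mean_value f (s *: v + x) u s _.
  move=> a a01; apply: df; rewrite addrA -scalerDr -[v]scale1r; exact: sD.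
have [|b b01 Eb] := @mean_value f x v s _.
  move=> b b01; apply: df; rewrite -[b *: v]add0r -(scale0r u); exact: sD.
have [|c c01 Ec] := @mean_value f x (u + v) s _.
  move=> c c01; apply: df; rewrite scalerDr; exact: sD.
have {Ea Eb Ec} E : 'D_(u + v) f (s *: (c *: (u + v)) + x) =
    'D_u f (s *: (a *: u) + (s *: v + x)) + 'D_v f (s *: (b *: v) + x).
  apply: (mulfI s0); rewrite mulrDr -Ea -Eb -Ec.
  by rewrite scalerDr -addrA subrKA.
have := sUV _ _ c01 c01; rewrite -scalerDr E.
have := sU _ _ a01 I1; have := sV _ _ I0 b01.
rewrite scale0r add0r scale1r (scalerDr s) -!addrA => ? ?; exact: dist_sum_le.
Qed.

(* Both mixed derivatives are limits of the same second difference quotient,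
   evaluated by two applications of the mean value theorem. *)
Lemma derive_comm D f x u v : open D -> D x ->
    (forall w y, D y -> derivable f y w) ->
    (forall w w' y, D y -> derivable ('D_w f) y w') ->
    (forall w w', {for x, continuous ('D_w' ('D_w f))}) ->
  'D_u ('D_v f) x = 'D_v ('D_u f) x.
Proof.
move=> oD Dx df ddf cf; apply/eqP; rewrite -subr_eq0 -normr_le0.
apply/ler_addgt0Pl => e e0; rewrite addr0.
have e2 : 0 < e / 2%:R by rewrite divr_gt0.
have I0 : (0 : R) <= (0 : R) <= (1 : R) by rewrite lexx ler01.
have I1 : (0 : R) <= (1 : R) <= (1 : R) by rewrite lexx ler01.
have H := near0_and (near_box_cvg u v (cf v u) e2) (near_box_cvg u v (cf u v) e2).
have H' := near0_and (open_near_box u v oD Dx) H.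
have [s s0 [sD [sVU sUV]]] := near0_ex H'.
have sD' a b (a01 : 0 <= a <= 1) (b01 : 0 <= b <= 1) :
    D (s *: (b *: v) + (s *: (a *: u) + x)).
  by rewrite addrA -scalerDr (addrC (b *: v)); exact: sD.
have second_difference u' v' :
    (forall a b : R, 0 <= a <= 1 -> 0 <= b <= 1 ->
      D (s *: (b *: v') + (s *: (a *: u') + x))) ->
  exists a b : R, [/\ 0 <= a <= 1, 0 <= b <= 1 &
    f (s *: v' + (s *: u' + x)) - f (s *: u' + x) - (f (s *: v' + x) - f x)
    = s * (s * 'D_v' ('D_u' f) (s *: (b *: v') + (s *: (a *: u') + x)))].
  move=> Duv; pose phi y := f (s *: v' + y) - f y.
  have dphi (a : R) : 0 <= a <= 1 -> is_derive (s *: (a *: u') + x) u' phi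
      ('D_u' f (s *: v' + (s *: (a *: u') + x)) - 'D_u' f (s *: (a *: u') + x)).
    move=> a01; set y := s *: (a *: u') + x.
    have Dy : D y by have := Duv a 0 a01 I0; rewrite scale0r scaler0 add0r.
    have Dvy : D (s *: v' + y) by have := Duv a 1 a01 I1; rewrite scale1r.
    have e1 r : f (r *: u' + (s *: v' + y)) = f (s *: v' + (r *: u' + y)).
      by rewrite addrCA.
    have dshift : is_derive y u' (fun y => f (s *: v' + y)) ('D_u' f (s *: v' + y)).
      apply: DeriveDef.
        exact: (@eq_derivable_line _ _ V V f (fun y => f (s *: v' + y)) _ _ _ _ e1
          (df u' _ Dvy)).
      exact/esym/(@eq_derive_line _ _ V V f (fun y => f (s *: v' + y)) _ _ _ _ e1).
    by apply: is_deriveB => //; apply: DeriveDef => //; exact: df.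
  have [|a a01 Ea] := @mean_value phi x u' s _.
    by move=> a /dphi[].
  have [|b b01 Eb] := @mean_value ('D_u' f) (s *: (a *: u') + x) v' s _.
    by move=> b b01; apply: ddf; exact: Duv.
  exists a, b; split=> //; rewrite -[LHS]/(phi (s *: u' + x) - phi x) Ea.
  by have [_ ->] := dphi _ a01; rewrite Eb.
have [a [b [a01 b01 E]]] := second_difference u v sD'.
have [|c [d [c01 d01 E']]] := second_difference v u.
  by move=> c d c01 d01; rewrite addrCA; exact: sD'.
have {E E'} E : 'D_u ('D_v f) (s *: (d *: u) + (s *: (c *: v) + x)) =
    'D_v ('D_u f) (s *: (b *: v) + (s *: (a *: u) + x)).
  do 2!apply: (mulfI s0); refine (etrans (esym E') (etrans _ E)).
  by rewrite (_ : s *: u + (s *: v + x) = s *: v + (s *: u + x)) 1?addrCA// subrAC4.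
apply: dist_eq_le (sVU d c d01 c01) (sUV a b a01 b01) _.
by rewrite (addrC (a *: u)) !(scalerDr s) -!(addrA _ _ x).
Qed.

End MeanValue.

(** * Maps of class C^k *)

Section ContinuouslyDifferentiable.
Variables (R : realType).
Implicit Types (V W : normedModType R).

Lemma Ck_continuous V W k (D : set V) (f : V -> W) x :
  Ck k D f -> D x -> {for x, continuous f}.
Proof. by case: k => [|k] [+ _] Dx; apply. Qed.

Lemma Ck_derivable V W k (D : set V) (f : V -> W) x v :
  Ck k.+1 D f -> D x -> derivable f x v.
Proof. by move=> [_ /(_ v)[+ _]]; apply. Qed.

Lemma Ck_derive V W k (D : set V) (f : V -> W) v :
  Ck k.+1 D f -> Ck k D ('D_v f).
Proof. by move=> [_ /(_ v)[]]. Qed.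

Lemma eq_Ck V W k (D : set V) (f f' : V -> W) : open D ->
  (forall x, D x -> f x = f' x) -> Ck k D f -> Ck k D f'.
Proof.
move=> oD; elim: k f f' => [|k IH] f f' ff' [cf df]; split => //.
- move=> x Dx; rewrite /prop_for /continuous_at -(ff' x Dx).
  apply: cvg_trans (cf x Dx); apply: near_eq_cvg; near=> y; apply: ff'.
  by near: y; exact: open_nbhs_nbhs.
- move=> x Dx; rewrite /prop_for /continuous_at -(ff' x Dx).
  apply: cvg_trans (cf x Dx); apply: near_eq_cvg; near=> y; apply: ff'.
  by near: y; exact: open_nbhs_nbhs.
- move=> v; have [dfv Cfv] := df v; split.
    by move=> x Dx; exact: eq_derivable_open oD Dx ff' (dfv x Dx).
  by apply: IH Cfv => x Dx; exact: eq_derive_open oD Dx ff'.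
Unshelve. all: by end_near. Qed.

(** A linear map sends lines to lines, so the difference quotients of f \o l along v are those of f
    along l v. Hence 'D_v (f \o l) = 'D_(l v) f \o l at every point, and the induction needs no
    chain rule. *)
Lemma Ck_comp_linear V V' W k (D : set V) (D' : set V') (l : V -> V')
    (f : V' -> W) :
    (forall (s : R) v x, l (s *: v + x) = s *: l v + l x) -> continuous l ->
    (forall x, D x -> D' (l x)) ->
  Ck k D' f -> Ck k D (f \o l).
Proof.
move=> ll cl DD'; elim: k f => [|k IH] f [cf df].
  by split=> // x Dx; apply: continuous_comp; [exact: cl|exact/cf/DD'].
split=> [x Dx|v]; first by apply: continuous_comp; [exact: cl|exact/cf/DD'].
have e x s : f (s *: l v + l x) = (f \o l) (s *: v + x) by rewrite /= ll.
have [dfv Cfv] := df (l v); split=> [x Dx|].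
  exact: (@eq_derivable_line _ _ V' V f (f \o l) _ _ _ _ (e x)
    (dfv _ (DD' _ Dx))).
suff -> : 'D_v (f \o l) = 'D_(l v) f \o l by exact: IH.
apply/funext => x; apply/esym.
exact: (@eq_derive_line _ _ V' V f (f \o l) _ _ _ _ (e x)).
Qed.

Lemma Ck_entry V m q k (D : set V) (f : V -> 'M[R]_(m, q)) i j : open D ->
  Ck k D f -> Ck k D (fun x => f x i j).
Proof.
move=> oD; elim: k f => [|k IH] f [cf df].
  split=> // x Dx.
  apply: (@continuous_comp _ _ _ f (fun M : 'M[R]_(m, q) => M i j)).
    exact: cf.
  exact: coord_continuous.
split=> [x Dx|v].
  apply: (@continuous_comp _ _ _ f (fun M : 'M[R]_(m, q) => M i j)).
    exact: cf.
  exact: coord_continuous.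
have [dfv Cfv] := df v; split=> [x Dx|].
  by have /derivable_mxP := dfv x Dx; apply.
apply: eq_Ck (IH _ Cfv) => // x Dx.
by rewrite derive_mx ?mxE//; exact: dfv.
Qed.

Lemma continuous_mx V m q (f : V -> 'M[R]_(m, q)) x :
  (forall i j, {for x, continuous (fun y => f y i j)}) -> {for x, continuous f}.
Proof.
move=> cf A [P fP PA]; rewrite /nbhs/=.
have : \forall y \near x, forall i j, P i j (f y i j).
  by apply: filter_forall => i; apply: filter_forall => j; exact: cf.
by apply: filterS => y; exact: PA.
Qed.

Lemma Ck_mx V m q k (D : set V) (f : V -> 'M[R]_(m, q)) : open D ->
  (forall i j, Ck k D (fun x => f x i j)) -> Ck k D f.
Proof.
move=> oD; elim: k f => [|k IH] f Cf.
  by split=> // x Dx; apply: continuous_mx => i j; exact: Ck_continuous (Cf i j) Dx.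
have df x v : D x -> derivable f x v.
  by move=> Dx; apply/derivable_mxP => i j; exact: Ck_derivable (Cf i j) Dx.
split=> [x Dx|v].
  by apply: continuous_mx => i j; exact: Ck_continuous (Cf i j) Dx.
split=> [x Dx|]; first exact: df.
apply: (@eq_Ck _ _ _ _ (fun x => \matrix_(i, j) 'D_v (fun y => f y i j) x)) => //.
  by move=> x Dx; rewrite derive_mx//; exact: df.
apply: IH => i j.
rewrite (_ : (fun x => _) = 'D_v (fun y => f y i j)).
  exact: Ck_derive (Cf i j).
by apply/funext => x; rewrite mxE.
Qed.

Lemma derivable_prod_seq V I (r : seq I) (P : pred I) (F : I -> V -> R) x v :
  (forall i, derivable (F i) x v) ->
  derivable (fun y => \prod_(i <- r | P i) F i y) x v.
Proof.
move=> dF; elim: r => [|i r IH].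
  rewrite (_ : (fun y => _) = cst 1); first exact: derivable_cst.
  by apply/funext => y; rewrite big_nil.
rewrite (_ : (fun y => _) =
  if P i then (fun y => F i y * \prod_(j <- r | P j) F j y)
  else (fun y => \prod_(j <- r | P j) F j y)).
  by case: (P i); [exact: derivableM|exact: IH].
by apply/funext => y; rewrite big_cons; case: (P i).
Qed.

Lemma derivable_sum_seq V I (r : seq I) (P : pred I) (F : I -> V -> R) x v :
  (forall i, derivable (F i) x v) ->
  derivable (fun y => \sum_(i <- r | P i) F i y) x v.
Proof.
move=> dF; elim: r => [|i r IH].
  rewrite (_ : (fun y => _) = cst 0); first exact: derivable_cst.
  by apply/funext => y; rewrite big_nil.
rewrite (_ : (fun y => _) =
  if P i then (fun y => F i y + \sum_(j <- r | P j) F j y)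
  else (fun y => \sum_(j <- r | P j) F j y)).
  by case: (P i); [exact: derivableD|exact: IH].
by apply/funext => y; rewrite big_cons; case: (P i).
Qed.

Lemma derivable_det V d (f : V -> 'M[R]_d) x v :
  (forall i j, derivable (fun y => f y i j) x v) ->
  derivable (fun y => \det (f y)) x v.
Proof.
move=> df; apply: derivable_sum_seq => s; apply: derivableM.
  exact: derivable_cst.
by apply: derivable_prod_seq => i; exact: df.
Qed.

(** Cramer's formula gives the inverse as a quotient of polynomials in the entries. It agrees with
    [invmx] only where the matrix is invertible, hence the open set D. *)
Lemma derivable_invmx V d (D : set V) (f : V -> 'M[R]_d) x v i j :
    open D -> D x -> (forall y, D y -> f y \in unitmx) ->
    (forall i j, derivable (fun y => f y i j) x v) ->
  derivable (fun y => invmx (f y) i j) x v.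
Proof.
move=> oD Dx uf df.
apply: (@eq_derivable_open _ _ _ D
  (fun y => (\det (f y))^-1 * cofactor (f y) j i)) => //.
  by move=> y Dy; rewrite /invmx uf// !mxE.
apply: derivableM.
  apply: derivableV; last exact: derivable_det.
  by have := uf x Dx; rewrite unitmxE unitfE.
apply: derivableM; first exact: derivable_cst.
apply: derivable_det => k l.
rewrite (_ : (fun y => _) = fun y => f y (lift j k) (lift i l)); first exact: df.
by apply/funext => y; rewrite !mxE.
Qed.

End ContinuouslyDifferentiable.

(** * Curvature in the adapted frame *)

Section FrameSums.
Variables (R : realType) (p n : nat).
Implicit Types (f : frame_index p n -> R) (A B : frame_index p n).

Lemma eq_sum_frame f f' : f =1 f' -> sum_frame f = sum_frame f'.
Proof. by move=> ff'; congr (sum_frame _); apply/funext. Qed.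

Lemma sum_frame0 : sum_frame (fun _ : frame_index p n => 0 : R) = 0.
Proof. by rewrite /sum_frame !big1 ?addr0// => i _; rewrite big1. Qed.

Lemma sum_frame_eq0 f : (forall A, f A = 0) -> sum_frame f = 0.
Proof. by move=> f0; rewrite (eq_sum_frame f0) sum_frame0. Qed.

Lemma sum_frameN f : sum_frame (fun A => - f A) = - sum_frame f.
Proof.
rewrite /sum_frame !sumrN !opprD; congr (_ + _).
by rewrite -sumrN; apply: eq_bigr => i _; rewrite sumrN.
Qed.

Definition kron A B : R :=
  match A, B with
  | tI al, tI be => (al == be)%:R
  | xI i, xI j => (i == j)%:R
  | vI i al, vI j be => ((i == j) && (al == be))%:R
  | _, _ => 0
  end.

Lemma sum_pred1 (I : finType) (F : I -> R) i : \sum_j (i == j)%:R * F j = F i.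
Proof.
rewrite (bigD1 i)//= eqxx mul1r big1 ?addr0// => j ji.
by rewrite eq_sym (negPf ji) mul0r.
Qed.

Lemma sum_pred2 (I J : finType) (F : I -> J -> R) i k :
  \sum_j \sum_l ((i == j) && (k == l))%:R * F j l = F i k.
Proof.
rewrite -[RHS](sum_pred1 (F i)) -[RHS](sum_pred1 (fun j => \sum_l _ * F j l)).
apply: eq_bigr => j _; rewrite mulr_sumr; apply: eq_bigr => l _.
by rewrite mulrA -natrM mulnb.
Qed.

Lemma sum_mul0 (I : finType) (F : I -> R) : \sum_j 0 * F j = 0.
Proof. by rewrite big1// => j _; rewrite mul0r. Qed.

Lemma sum_frame_kron f B : sum_frame (fun A => kron B A * f A) = f B.
Proof.
rewrite /sum_frame; case: B => [be|j|j be] /=;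
  rewrite ?sum_pred1 ?sum_pred2 ?sum_mul0 ?addr0 ?add0r//;
  (rewrite [X in _ + X]big1 ?addr0// => i _; rewrite sum_mul0//).
Qed.

End FrameSums.

Section AdaptedFrame.
Variables (R : realType) (p n : nat) (S : connection_data R p n).
Implicit Types (f : jet R p n -> R) (X Y : vector_field R p n).
Implicit Types (A B C D E : frame_index p n) (z : jet R p n).

Lemma adaptedE A B z : adapted S A B z =
  match A, B with
  | tI al, vI j be => - cM S j be al z
  | xI i, vI j be => - cN S j be i z
  | _, _ => kron R B A
  end.
Proof. by case: A => [al|i|i al]; case: B => [be|j|j be]. Qed.

(** The adapted frame is unitriangular over the coordinate frame: horizontal components are read off
    directly, and the terms in [cM] and [cN] of [coef] cancel the vertical parts of the horizontal
    fields. *)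
Lemma coef_sum_adapted (c : frame_index p n -> jet R p n -> R) D z :
  coef S D (fun E w => sum_frame (fun D' => c D' w * adapted S D' E w)) z
  = c D z.
Proof.
have T al w :
    sum_frame (fun D' => c D' w * adapted S D' (tI al) w) = c (tI al) w.
  rewrite -[RHS](sum_frame_kron (fun D' => c D' w)); apply: eq_sum_frame => B.
  by rewrite adaptedE mulrC; case: B.
have X i w :
    sum_frame (fun D' => c D' w * adapted S D' (xI i) w) = c (xI i) w.
  rewrite -[RHS](sum_frame_kron (fun D' => c D' w)); apply: eq_sum_frame => B.
  by rewrite adaptedE mulrC; case: B.
case: D => [al|i|i al] /=; [exact: T|exact: X|].
under eq_bigr do rewrite T.
under [X in _ + X]eq_bigr do rewrite X.
rewrite /sum_frame /=.
under [X in _ + X + _ + _]eq_bigr do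
  under eq_bigr do rewrite mulrC.
rewrite (sum_pred2 (fun j be => c (vI j be) z)) -addrA addrAC addrACA.
by rewrite -!big_split/= !big1 ?add0r// => j _; rewrite mulrN mulrC addNr.
Qed.

Lemma act_kron X A B z : act X (fun=> kron R A B) z = 0.
Proof.
by apply: sum_frame_eq0 => E; rewrite /pd derive_cst mulr0.
Qed.

Lemma coef_adapted A D : coef S D (adapted S A) = fun=> kron R D A.
Proof.
apply/funext => z; rewrite -[RHS](coef_sum_adapted (fun D _ => kron R D A) D z).
congr (coef S D _ z); apply/funext => E; apply/funext => w.
rewrite -[LHS](sum_frame_kron (fun D => adapted S D E w)).
apply: eq_sum_frame => B; congr (_ * _).
by case: A B => [al|i|i al] [be|j|j be] //=; rewrite ?(eq_sym i j) ?(eq_sym al be).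
Qed.

Lemma coef_nabla X Y D : coef S D (nabla S X Y) = fun z =>
  act X (coef S D Y) z
  + sum_frame (fun A => sum_frame (fun B =>
      coef S A X z * coef S B Y z * conn S A B D z)).
Proof. by apply/funext => z; rewrite coef_sum_adapted. Qed.

Lemma sum_frameZ (x : R) (f : frame_index p n -> R) :
  sum_frame (fun A => x * f A) = x * sum_frame f.
Proof.
rewrite /sum_frame !mulrDr !mulr_sumr; congr (_ + _).
by apply: eq_bigr => i _; rewrite mulr_sumr.
Qed.

Lemma sum_frame_kronC (f : frame_index p n -> R) B :
  sum_frame (fun A => kron R A B * f A) = f B.
Proof.
rewrite -[RHS](sum_frame_kron f); apply: eq_sum_frame => A; congr (_ * _).
by case: A B => [al|i|i al] [be|j|j be] //=; rewrite ?(eq_sym i j) ?(eq_sym al be).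
Qed.

Lemma coef_nabla_adapted A C D :
  coef S D (nabla S (adapted S A) (adapted S C)) = conn S A C D.
Proof.
rewrite coef_nabla; apply/funext => z; rewrite coef_adapted act_kron add0r.
rewrite -[RHS](sum_frame_kronC (fun A => conn S A C D z)).
apply: eq_sum_frame => E.
rewrite coef_adapted -(sum_frame_kronC (fun C => conn S E C D z)).
by rewrite -sum_frameZ; apply: eq_sum_frame => F; rewrite coef_adapted mulrA.
Qed.

(* The adapted frame is anholonomic only in the vertical directions. *)
Definition bracket_v A B i al z : R :=
  delta S A (adapted S B (vI i al)) z - delta S B (adapted S A (vI i al)) z.

(** The non-vertical components of adapted fields are constants, so the bracket has none; the
    corrections in [coef], which involve only those components, vanish as well. *)
Lemma coef_bracket A B E z :
  coef S E (lie_bracket (adapted S A) (adapted S B)) z =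
  if E is vI i al then bracket_v A B i al z else 0.
Proof.
have cst0 C E' : ~~ is_v E' ->
    delta S A (adapted S C E') z = 0 /\ delta S B (adapted S C E') z = 0.
  move=> E'v; rewrite /delta (_ : adapted S C E' = fun=> kron R E' C) ?act_kron//.
  by apply/funext => w; case: C E' E'v => [al|i|i al] [be|j|j be].
have br0 E' : ~~ is_v E' ->
    lie_bracket (adapted S A) (adapted S B) E' z = 0.
  move=> /[dup] /(cst0 A)[_ e2] /(cst0 B)[e1 _].
  by rewrite /lie_bracket -!/(delta _ _ _) e1 e2 subrr.
case: E => [al|i|i al]; rewrite ?[LHS]br0//=.
by rewrite !big1 ?addr0// => j _; rewrite br0// mulr0.
Qed.

Lemma coefB D X Y z :
  coef S D (fun E w => X E w - Y E w) z = coef S D X z - coef S D Y z.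
Proof.
case: D => [al|i|i al] //=.
under eq_bigr do rewrite mulrBr.
under [X in _ + _ + X]eq_bigr do rewrite mulrBr.
by rewrite !sumrB; ring.
Qed.

Lemma curvE A B C D z : curv S A B C D z =
  delta S A (conn S B C D) z
    + sum_frame (fun E => conn S B C E z * conn S A E D z)
  - (delta S B (conn S A C D) z
     + sum_frame (fun E => conn S A C E z * conn S B E D z))
  - \sum_i \sum_al bracket_v A B i al z * conn S (vI i al) C D z.
Proof.
rewrite /curv /curvature coefB coefB; congr (_ - _ - _).
- rewrite coef_nabla coef_nabla_adapted; congr (_ + _).
  rewrite -[RHS](sum_frame_kronC (fun A => sum_frame (fun E =>
    conn S B C E z * conn S A E D z))).
  apply: eq_sum_frame => E; rewrite -sum_frameZ; apply: eq_sum_frame => F.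
  by rewrite coef_adapted coef_nabla_adapted mulrA.
- rewrite coef_nabla coef_nabla_adapted; congr (_ + _).
  rewrite -[RHS](sum_frame_kronC (fun B => sum_frame (fun E =>
    conn S A C E z * conn S B E D z))).
  apply: eq_sum_frame => E; rewrite -sum_frameZ; apply: eq_sum_frame => F.
  by rewrite coef_adapted coef_nabla_adapted mulrA.
- rewrite coef_nabla coef_adapted act_kron add0r.
  under eq_sum_frame => E.
    under eq_sum_frame do rewrite coef_adapted coef_bracket mulrAC mulrC.
    rewrite (sum_frame_kronC (fun F =>
      (if E is vI i al then bracket_v A B i al z else 0) * conn S E F D z)).
    over.
  rewrite /sum_frame big1 ?add0r => [|i _]; last by rewrite mul0r.
  by rewrite big1 ?add0r => [|i _]; last by rewrite mul0r.
Qed.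

Lemma curv_antisym A B C D z : curv S A B C D z = - curv S B A C D z.
Proof.
rewrite !curvE opprB addrC [in RHS]opprB; congr (_ + _).
rewrite -sumrN; apply: eq_bigr => i _; rewrite -sumrN; apply: eq_bigr => al _.
by rewrite -mulNr opprB.
Qed.

(** For p = 1 this disposes of the pair of two temporal directions. *)
Lemma curv_diag A C D z : curv S A A C D z = 0.
Proof. by apply/eqP; rewrite -eqNr -curv_antisym. Qed.

End AdaptedFrame.

Section CurvatureComponents.
Variables (R : realType) (p n : nat) (S : connection_data R p n).
Implicit Types (f : jet R p n -> R) (A B C D E : frame_index p n).
Implicit Types (z w : jet R p n).

Lemma delta_vE j be f z : delta S (vI j be) f z = pd (vI j be) f z.
Proof.
rewrite -[RHS](sum_frame_kronC (fun E => pd E f z)); apply: eq_sum_frame => E.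
by rewrite adaptedE; case: E.
Qed.

Lemma delta_xE k f z : delta S (xI k) f z =
  pd (xI k) f z - \sum_j \sum_be cN S j be k z * pd (vI j be) f z.
Proof.
rewrite -[LHS]/(\sum_be 0 * pd (tI be) f z
  + \sum_i (i == k)%:R * pd (xI i) f z
  + \sum_j \sum_be - cN S j be k z * pd (vI j be) f z).
rewrite [X in X + _ + _]sum_mul0 add0r.
congr (_ + _).
  by under eq_bigr do rewrite eq_sym; rewrite sum_pred1.
rewrite -sumrN; apply: eq_bigr => j _; rewrite -sumrN.
by apply: eq_bigr => be _; rewrite mulNr.
Qed.

Lemma delta_tE al f z : delta S (tI al) f z =
  pd (tI al) f z - \sum_j \sum_be cM S j be al z * pd (vI j be) f z.
Proof.
rewrite -[LHS]/(\sum_be (be == al)%:R * pd (tI be) f z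
  + \sum_i 0 * pd (xI i) f z
  + \sum_j \sum_be - cM S j be al z * pd (vI j be) f z).
rewrite [X in _ + X + _]sum_mul0 addr0; congr (_ + _).
  by under eq_bigr do rewrite eq_sym; rewrite sum_pred1.
rewrite -sumrN; apply: eq_bigr => j _; rewrite -sumrN.
by apply: eq_bigr => be _; rewrite mulNr.
Qed.

Lemma deltaN A f z : delta S A (fun w => - f w) z = - delta S A f z.
Proof.
rewrite /delta /act -sum_frameN; apply: eq_sum_frame => E.
by rewrite /pd deriveN_any mulrN.
Qed.

Lemma delta_cst A (c : R) z : delta S A (fun=> c) z = 0.
Proof. by apply: sum_frame_eq0 => E; rewrite /pd derive_cst mulr0. Qed.

(** Only a temporal adapted field has a component along a coordinate t^al; for the other fields,
    changes in the dependence on t alone go unnoticed. *)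
Lemma eq_delta A f f' z :
    (forall E, (is_t E -> is_t A) -> pd E f z = pd E f' z) ->
  delta S A f z = delta S A f' z.
Proof.
move=> ff'; apply: eq_sum_frame => E.
have [EA|] := boolP (is_t E ==> is_t A); first by rewrite ff'//; apply/implyP.
rewrite negb_imply => EA; suff -> : adapted S A E z = 0 by rewrite !mul0r.
by rewrite adaptedE; case: A E EA {ff'} => [al|i|i al] [be|j|j be].
Qed.

(** Required at all points, not just on a chart domain as in [base_only]: [lift_h] reads only t, so
    its Christoffel symbols satisfy this everywhere. *)
Definition time_only f := forall w w', w.1.1 = w'.1.1 -> f w = f w'.

Lemma time_only_line E f z (s : R) : ~~ is_t E -> time_only f ->
  f (s *: coord_vector R E + z) = f z.
Proof.
move=> Et; apply; case: E Et => [//|i|i al] _ /=; by rewrite scaler0 add0r.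
Qed.

Lemma delta_time_only A c z : ~~ is_t A -> time_only c -> delta S A c z = 0.
Proof.
move=> At tc; rewrite -[RHS](delta_cst A 0 z); apply: eq_delta => E EA.
rewrite /pd derive_cst derive_const_line// => s; apply: time_only_line => //.
exact: contra At.
Qed.

Lemma deltaD_time_only A f c z : ~~ is_t A -> time_only c ->
  delta S A (fun w => f w + c w) z = delta S A f z.
Proof.
move=> At tc; apply: eq_delta => E EA; rewrite /pd deriveD_const// => s.
apply: time_only_line => //; exact: contra At.
Qed.

Lemma conn_block A C D z : ~~ same_block C D -> conn S A C D z = 0.
Proof. by case: A C D => [?|?|? ?] [?|?|? ?] [?|?|? ?]. Qed.

Lemma same_block_trans C D E : same_block C E -> same_block E D -> same_block C D.
Proof. by case: C D E => [?|?|? ?] [?|?|? ?] [?|?|? ?]. Qed.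

(** Covariant differentiation preserves the three distributions of the frame, hence so does every
    term of the curvature. *)
Lemma curv_block A B C D z : ~~ same_block C D -> curv S A B C D z = 0.
Proof.
move=> CD; have c0 A' : conn S A' C D = fun=> 0.
  by apply/funext => w; rewrite conn_block.
have s0 A' B' : sum_frame (fun E => conn S B' C E z * conn S A' E D z) = 0.
  apply: sum_frame_eq0 => E; have [CE|CE] := boolP (same_block C E).
    rewrite (@conn_block A') ?mulr0//; apply: contra CD; exact: same_block_trans.
  by rewrite conn_block ?mul0r.
rewrite curvE !c0 !s0 !delta_cst !(addr0, oppr0) big1 ?subr0// => i _.
by rewrite big1// => al _; rewrite c0 mulr0.
Qed.

(** The vertical distribution carries the tensor product of the connection on the [xI]-block with
    the dual of the one on the [tI]-block. The latter vanishes in non-temporal directions, so one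
    formula covers all rows of [conn]. *)
Lemma conn_vI A i al l eta z : conn S A (vI i al) (vI l eta) z =
  (eta == al)%:R * conn S A (xI i) (xI l) z
  - (l == i)%:R * conn S A (tI eta) (tI al) z.
Proof. by case: A => [ga|j|j ga] /=; rewrite ?mulr0 ?subr0// (eq_sym al). Qed.

Lemma curv_xI A B i l z : curv S A B (xI i) (xI l) z =
  delta S A (conn S B (xI i) (xI l)) z - delta S B (conn S A (xI i) (xI l)) z
  + \sum_m conn S B (xI i) (xI m) z * conn S A (xI m) (xI l) z
  - \sum_m conn S A (xI i) (xI m) z * conn S B (xI m) (xI l) z
  - \sum_m \sum_mu bracket_v S A B m mu z * cC S l i m mu z.
Proof.
have s A' B' :
    sum_frame (fun E => conn S B' (xI i) E z * conn S A' E (xI l) z) =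
    \sum_m conn S B' (xI i) (xI m) z * conn S A' (xI m) (xI l) z.
  rewrite /sum_frame big1 => [|al _]; last by rewrite conn_block ?mul0r.
  rewrite add0r [X in _ + X]big1 ?addr0// => j _; rewrite big1// => al _.
by rewrite curvE !s; ring.
Qed.

Lemma curv_tI A B eta al z : curv S A B (tI eta) (tI al) z =
  delta S A (conn S B (tI eta) (tI al)) z
  - delta S B (conn S A (tI eta) (tI al)) z
  + \sum_mu conn S B (tI eta) (tI mu) z * conn S A (tI mu) (tI al) z
  - \sum_mu conn S A (tI eta) (tI mu) z * conn S B (tI mu) (tI al) z.
Proof.
have s A' B' :
    sum_frame (fun E => conn S B' (tI eta) E z * conn S A' E (tI al) z) =
    \sum_mu conn S B' (tI eta) (tI mu) z * conn S A' (tI mu) (tI al) z.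
  rewrite /sum_frame -addrA -[RHS]addr0; congr (_ + _).
  rewrite !big1 ?addr0// => j _; last by rewrite conn_block ?mul0r.
  by rewrite big1// => be _; rewrite conn_block ?mul0r.
rewrite curvE !s [X in _ - X = _]big1; first by ring.
by move=> i _; rewrite big1// => be _; rewrite /= mulr0.
Qed.

(* The mixed products of xI- and tI-coefficients add up to an expression
   symmetric in A and B, hence drop out of the curvature. *)
Lemma curv_vI A B i al l eta z :
    (forall A' B', (A', B') = (A, B) \/ (A', B') = (B, A) ->
      delta S A' (conn S B' (vI i al) (vI l eta)) z =
      (eta == al)%:R * delta S A' (conn S B' (xI i) (xI l)) z
      - (l == i)%:R * delta S A' (conn S B' (tI eta) (tI al)) z) ->
  curv S A B (vI i al) (vI l eta) z =
  (eta == al)%:R * curv S A B (xI i) (xI l) z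
  - (l == i)%:R * curv S A B (tI eta) (tI al) z.
Proof.
(* This hypothesis isolates the linearity of the derivation on the two-term coefficient: for pairs
   that are not both temporal it follows from H depending on t alone, for temporal pairs from
   differentiability. *)
move=> split_delta.
have s A' B' :
    sum_frame (fun E => conn S B' (vI i al) E z * conn S A' E (vI l eta) z) =
    (eta == al)%:R
      * \sum_m conn S B' (xI i) (xI m) z * conn S A' (xI m) (xI l) z
    - conn S B' (xI i) (xI l) z * conn S A' (tI eta) (tI al) z
    - conn S B' (tI eta) (tI al) z * conn S A' (xI i) (xI l) z
    + (l == i)%:R
      * \sum_mu conn S A' (tI eta) (tI mu) z * conn S B' (tI mu) (tI al) z.
  rewrite /sum_frame big1 => [|be _]; last by rewrite conn_block ?mul0r.
  rewrite big1 ?add0r => [|j _]; last by rewrite conn_block ?mul0r.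
  transitivity (\sum_m \sum_mu
      ((al == mu)%:R * ((eta == mu)%:R *
         (conn S B' (xI i) (xI m) z * conn S A' (xI m) (xI l) z))
       - ((l == m) && (al == mu))%:R *
         (conn S B' (xI i) (xI m) z * conn S A' (tI eta) (tI mu) z)
       - ((i == m) && (eta == mu))%:R *
         (conn S B' (tI mu) (tI al) z * conn S A' (xI m) (xI l) z)
       + (i == m)%:R * ((l == m)%:R *
         (conn S A' (tI eta) (tI mu) z * conn S B' (tI mu) (tI al) z)))).
    apply: eq_bigr => m _; apply: eq_bigr => mu _.
    rewrite !conn_vI -!mulnb !natrM (eq_sym mu) (eq_sym m); ring.
  under eq_bigr do rewrite big_split/= !sumrB.
  rewrite big_split/= !sumrB (sum_pred2 (fun m mu =>
    conn S B' (xI i) (xI m) z * conn S A' (tI eta) (tI mu) z)).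
  rewrite (sum_pred2 (fun m mu =>
    conn S B' (tI mu) (tI al) z * conn S A' (xI m) (xI l) z)).
  congr (_ - _ - _ + _).
    rewrite mulr_sumr; apply: eq_bigr => m _; by rewrite sum_pred1.
  rewrite exchange_big mulr_sumr; apply: eq_bigr => mu _; by rewrite sum_pred1.
have b : \sum_m \sum_mu
      bracket_v S A B m mu z * conn S (vI m mu) (vI i al) (vI l eta) z
    = (eta == al)%:R * \sum_m \sum_mu bracket_v S A B m mu z * cC S l i m mu z.
  rewrite mulr_sumr; apply: eq_bigr => m _.
  by rewrite mulr_sumr; apply: eq_bigr => mu _; rewrite mulrCA.
rewrite curvE !s b !split_delta ?curv_xI ?curv_tI; [ring|by right|by left].
Qed.

(** The case distinction on b replaces the rule for constant multiples, so that f may be an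
    arbitrary function. *)
Lemma boolr_mul_delta A (b : bool) f z :
  delta S A (fun w => b%:R * f w) z = b%:R * delta S A f z.
Proof.
case: b; last first.
  rewrite mul0r -[RHS](delta_cst A 0 z); congr (delta S A _ z).
  by apply/funext => w; rewrite mul0r.
by rewrite mul1r; congr (delta S A _ z); apply/funext => w; rewrite mul1r.
Qed.

Section TimeOnly.
Hypothesis cH_time_only : forall al be ga, time_only (cH S al be ga).

Lemma conn_tI_time_only A eta al : time_only (conn S A (tI eta) (tI al)).
Proof. by case: A => [ga|//|//] w w' ww' /=; exact: cH_time_only. Qed.

Lemma delta_conn_tI A B eta al z : ~~ (is_t A && is_t B) ->
  delta S A (conn S B (tI eta) (tI al)) z = 0.
Proof.
case: (boolP (is_t A)) => [At Bt|At _]; last first.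
  by apply: delta_time_only => //; exact: conn_tI_time_only.
by rewrite -[RHS](delta_cst A 0 z); case: B Bt => // ?; rewrite At.
Qed.

Lemma curv_tI_eq0 A B eta al z : ~~ (is_t A && is_t B) ->
  curv S A B (tI eta) (tI al) z = 0.
Proof.
move=> AB; rewrite curv_tI !delta_conn_tI// 1?andbC// subrr add0r.
rewrite !big1 ?subrr ?addr0// => mu _;
  by case: A B AB => [?|?|? ?] [?|?|? ?]//= _; rewrite ?mulr0 ?mul0r.
Qed.

(** If A is temporal then B is not, and the H-part of the coefficient is identically zero. Otherwise
    the H-part is constant along every line that [delta S A] involves and leaves the difference
    quotients unchanged. *)
Lemma delta_conn_vI A B i al l eta z : ~~ (is_t A && is_t B) ->
  delta S A (conn S B (vI i al) (vI l eta)) z =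
  (eta == al)%:R * delta S A (conn S B (xI i) (xI l)) z.
Proof.
move=> AB; rewrite -boolr_mul_delta.
have -> : conn S B (vI i al) (vI l eta) = fun w =>
    (eta == al)%:R * conn S B (xI i) (xI l) w
    + - ((l == i)%:R * conn S B (tI eta) (tI al) w).
  by apply/funext => w; rewrite conn_vI.
case: (boolP (is_t A)) AB => [At Bt|At _].
  congr (delta S A _ z); apply/funext => w.
  by case: B Bt => // *; rewrite ?At// mulr0 subr0.
apply: deltaD_time_only At _ => w w' ww'.
by congr (- (_ * _)); exact: conn_tI_time_only.
Qed.

Lemma curv_vI_xI A B i al l eta z : ~~ (is_t A && is_t B) ->
  curv S A B (vI i al) (vI l eta) z = (al == eta)%:R * curv S A B (xI i) (xI l) z.
Proof.
move=> AB; rewrite curv_vI => [|A' B' AB'].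
  by rewrite curv_tI_eq0// mulr0 subr0 eq_sym.
have {AB' AB} AB : ~~ (is_t A' && is_t B').
  by case: AB' => -[-> ->]//; rewrite andbC.
by rewrite delta_conn_vI// delta_conn_tI// mulr0 subr0.
Qed.

Lemma delta_tI_time_only al c z : time_only c ->
  delta S (tI al) c z = pd (tI al) c z.
Proof.
move=> tc; rewrite delta_tE big1 ?subr0// => j _; rewrite big1// => be _.
by rewrite /pd derive_const_line ?mulr0// => s; exact: time_only_line.
Qed.

Lemma curv_ttt al be ga eta z : curv S (tI ga) (tI be) (tI eta) (tI al) z =
  pd (tI ga) (cH S al eta be) z - pd (tI be) (cH S al eta ga) z
  + \sum_mu cH S mu eta be z * cH S al mu ga z
  - \sum_mu cH S mu eta ga z * cH S al mu be z.
Proof.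
rewrite curv_tI (delta_tI_time_only _ _ (@cH_time_only al eta be)).
by rewrite (delta_tI_time_only _ _ (@cH_time_only al eta ga)).
Qed.

End TimeOnly.

End CurvatureComponents.

Lemma lift_h_time_only (R : realType) p n (h : 'rV[R]_p -> 'M[R]_p) al be ga :
  time_only (chrisT (lift_h (n := n) h) al be ga).
Proof.
move=> w w' ww'; apply: eq_bigr => mu _.
have e E i j : pd E (fun v => lift_h (n := n) h v i j) w =
    pd E (fun v => lift_h (n := n) h v i j) w'.
  by apply: eq_derive_line => s; congr (h _ i j); congr (_ + _).
by rewrite !e /invm /lift_h ww'.
Qed.

(** * One temporal parameter: brackets as torsions, and the five curvatures *)

Section OneTime.
Variables (R : realType) (n : nat) (S : connection_data R 1 n).
Hypothesis cH_time_only : forall al be ga, time_only (cH S al be ga).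
Let o : 'I_1 := ord0.
Implicit Types (z w : jet R 1 n).

Lemma bracket_xt k m z :
  bracket_v S (xI k) (tI o) m o z = - torRt S o m k z.
Proof.
rewrite -[LHS]/(delta S (xI k) (fun w => - cM S m o o w) z
  - delta S (tI o) (fun w => - cN S m o k w) z).
rewrite (deltaN _ _ (cM S m o o)) (deltaN _ _ (cN S m o k)).
by rewrite /torRt opprB opprK addrC.
Qed.

Lemma bracket_xx k j m z :
  bracket_v S (xI k) (xI j) m o z = - torRx S o m j k z.
Proof.
rewrite -[LHS]/(delta S (xI k) (fun w => - cN S m o j w) z
  - delta S (xI j) (fun w => - cN S m o k w) z).
rewrite (deltaN _ _ (cN S m o j)) (deltaN _ _ (cN S m o k)).
by rewrite /torRx opprB opprK addrC.
Qed.

(** M^(m)_(1)1 = - H y^m is linear along the fibre. This bracket is the source of the term [cC * cH]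
    in [covCt]. *)
Lemma bracket_vt k m z :
  bracket_v S (vI k o) (tI o) m o z = (k == m)%:R * cH S o o o z.
Proof.
rewrite -[LHS]/(delta S (vI k o) (fun w => - cM S m o o w) z
  - delta S (tI o) (fun=> ((m == k) && (o == o))%:R) z).
rewrite delta_cst (deltaN _ _ (cM S m o o)) subr0 delta_vE.
rewrite (_ : cM S m o o = fun w => - (cH S o o o w * w.2 m o)); last first.
  by apply/funext => w; rewrite /cM /temporal big_ord1.
rewrite {1}/pd deriveN_any opprK.
have H0 s : cH S o o o (s *: coord_vector R (vI k o) + z) = cH S o o o z.
  exact: time_only_line.
have D : is_derive z (coord_vector R (vI k o))
    (fun w : jet R 1 n => w.2 m o) (k == m)%:R.
  by apply: derive_affine => s; rewrite /= !mxE eqxx andbT (eq_sym m).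
by rewrite deriveM_const// derive_val mulrC.
Qed.

Lemma bracket_vx k j m z :
  bracket_v S (vI k o) (xI j) m o z = - pd (vI k o) (cN S m o j) z.
Proof.
rewrite -[LHS]/(delta S (vI k o) (fun w => - cN S m o j w) z
  - delta S (xI j) (fun=> ((m == k) && (o == o))%:R) z).
by rewrite delta_cst (deltaN _ _ (cN S m o j)) subr0 delta_vE.
Qed.

Lemma bracket_vv k j m z : bracket_v S (vI k o) (vI j o) m o z = 0.
Proof. by rewrite /bracket_v /= !delta_cst subrr. Qed.

Lemma curv_xt1 i l k z : curv S (xI k) (tI o) (xI i) (xI l) z =
  delta S (xI k) (cG S l i o) z - delta S (tI o) (cL S l i k) z
  + \sum_m cG S m i o z * cL S l m k z - \sum_m cL S m i k z * cG S l m o z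
  + \sum_m cC S l i m o z * torRt S o m k z.
Proof.
rewrite curv_xI; congr (_ + _); rewrite -sumrN; apply: eq_bigr => m _.
by rewrite big_ord1 bracket_xt mulNr opprK mulrC.
Qed.

Lemma curv_xx1 i l j k z : curv S (xI k) (xI j) (xI i) (xI l) z =
  delta S (xI k) (cL S l i j) z - delta S (xI j) (cL S l i k) z
  + \sum_m cL S m i j z * cL S l m k z - \sum_m cL S m i k z * cL S l m j z
  + \sum_m cC S l i m o z * torRx S o m j k z.
Proof.
rewrite curv_xI; congr (_ + _); rewrite -sumrN; apply: eq_bigr => m _.
by rewrite big_ord1 bracket_xx mulNr opprK mulrC.
Qed.

(** The torsion sum cancels the third sum of [covCt], the one that acts on the index k; neither
    occurs in the expansion [curv_xI]. *)
Lemma curv_vt1 i l k z : curv S (vI k o) (tI o) (xI i) (xI l) z =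
  pd (vI k o) (cG S l i o) z - covCt S o l i k z
  + \sum_m cC S l i m o z * torPt S o m k z.
Proof.
rewrite curv_xI delta_vE /covCt /torPt /=.
under [X in _ - X = _]eq_bigr do rewrite big_ord1 bracket_vt -mulrA.
rewrite sum_pred1.
under [X in _ = _ + X]eq_bigr do rewrite mulrN.
under [X in _ + X - _ - _ = _]eq_bigr do rewrite mulrC.
rewrite sumrN; ring.
Qed.

(** The L-part of [torPx] cancels the third sum of [covCx]; what remains of the torsion is the
    derivative of N coming from the bracket. *)
Lemma curv_vx1 i l j k z : curv S (vI k o) (xI j) (xI i) (xI l) z =
  pd (vI k o) (cL S l i j) z - covCx S o l i k j z
  + \sum_m cC S l i m o z * torPx S o m j k z.
Proof.
rewrite curv_xI delta_vE /covCx /torPx /=.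
under [X in _ - X = _]eq_bigr do rewrite big_ord1 bracket_vx mulNr mulrC.
under [X in _ = _ + X]eq_bigr do rewrite mulrBr.
under [X in _ + X - _ - _ = _]eq_bigr do rewrite mulrC.
rewrite sumrN sumrB; ring.
Qed.

Lemma curv_vv1 i l j k z : curv S (vI k o) (vI j o) (xI i) (xI l) z =
  pd (vI k o) (cC S l i j o) z - pd (vI j o) (cC S l i k o) z
  + \sum_m cC S m i j o z * cC S l m k o z
  - \sum_m cC S m i k o z * cC S l m j o z.
Proof.
rewrite curv_xI !delta_vE [X in _ - X = _]big1 ?subr0// => m _.
by rewrite big_ord1 bracket_vv mul0r.
Qed.

Lemma curv_eq0_one_time A B C D z :
  [|| ~~ same_block C D, is_t C | is_t A && is_t B] -> curv S A B C D z = 0.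
Proof.
case: (boolP (same_block C D)) => [CD /=|CD _]; last exact: curv_block.
have [|AB] := boolP (is_t A && is_t B).
  by case: A B => [al|//|//] [be|//|//] _ _; rewrite (ord1 al) (ord1 be) curv_diag.
by rewrite orbF; case: C D CD => [eta|//|//] [al|//|//] _ _; exact: curv_tI_eq0.
Qed.

End OneTime.

(** * Metrics constant along the fibres *)

Section FibredDomain.
Variables (R : realType) (p n : nat) (D : set (jet R p n)).
Hypothesis oD : open D.
Hypothesis D_fibred : forall w w', D w -> w'.1 = w.1 -> D w'.
Implicit Types (f : jet R p n -> R) (A B C E : frame_index p n).
Implicit Types (w z : jet R p n).

(** Stated relative to D because g is controlled only over the chart domain. *)
Definition base_only f := forall w w', D w -> w'.1 = w.1 -> f w' = f w.

Lemma pd_base_only E f : base_only f -> base_only (pd E f).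
Proof.
move=> bf w w' Dw ww'; apply: (near_eq_diff_quotient _).1.
have := open_near_line (coord_vector R E) oD Dw.
apply: filterS => s Ds; rewrite (bf _ _ Dw ww'); congr (_ - _).
by apply: bf Ds _; congr (_ + _).
Qed.

Lemma pd_v_base_only i al f z : base_only f -> D z -> pd (vI i al) f z = 0.
Proof.
move=> bf Dz; rewrite /pd derive_const_line// => s; apply: bf Dz _.
by rewrite /= scaler0 add0r.
Qed.

Lemma eq_pd E f f' z : D z -> (forall w, D w -> f w = f' w) ->
  pd E f z = pd E f' z.
Proof. by move=> Dz ff'; exact: eq_derive_open oD Dz ff'. Qed.

Lemma time_only_base f : time_only f -> base_only f.
Proof. by move=> tf w w' _ ww'; apply: tf; rewrite ww'. Qed.

Variable (h : 'rV[R]_p -> 'M[R]_p) (g : jet R p n -> 'M[R]_n).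
Variable N : 'I_n -> 'I_p -> 'I_n -> jet R p n -> R.
Hypothesis g_base : forall w w', D w -> w'.1 = w.1 -> g w' = g w.
Hypothesis g_sym : forall w, D w -> (g w)^T = g w.
Let S := ConnectionData (lift_h h) g N.

(** All corrections in the adapted fields are vertical. This is how N disappears and [cL] becomes
    [chrisM]. *)
Lemma delta_base_only E f z : base_only f -> D z -> delta S E f z = pd E f z.
Proof.
move=> bf Dz; case: E => [al|i|i al];
  rewrite ?delta_vE// ?delta_xE ?delta_tE big1 ?subr0// => j _;
  by rewrite big1// => be _; rewrite pd_v_base_only// mulr0.
Qed.

Lemma eq_delta_open E f f' z : D z -> (forall w, D w -> f w = f' w) ->
  delta S E f z = delta S E f' z.
Proof. by move=> Dz ff'; apply: eq_delta => F _; exact: eq_pd. Qed.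

Lemma g_entry_base i j : base_only (fun w => g w i j).
Proof. by move=> w w' Dw ww'; rewrite (g_base Dw ww'). Qed.

Lemma cCE0 i j k ga z : D z -> cC S i j k ga z = 0.
Proof.
move=> Dz; apply: big1 => m _.
by rewrite !pd_v_base_only ?(addr0, subr0, mulr0)//; exact: g_entry_base.
Qed.

Lemma cLE i j k z : D z -> cL S i j k z = chrisM g i j k z.
Proof.
move=> Dz; apply: eq_bigr => m _.
(* [cL] and [chrisM] write the two indices of g in opposite orders; symmetry holds only on D, whose
   openness lets it pass under the derivative. *)
have pd_sym E a b : pd E (fun w => g w a b) z = pd E (fun w => g w b a) z.
  by apply: eq_pd => // w Dw; rewrite -[in LHS](g_sym Dw) mxE.
congr (_ * (_ + _ - _)).
- by rewrite delta_base_only; [exact: pd_sym|exact: g_entry_base|].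
- by rewrite delta_base_only; [exact: pd_sym|exact: g_entry_base|].
- by rewrite delta_base_only; [|exact: g_entry_base|].
Qed.

Lemma chrisM_base l j k : base_only (chrisM g l j k).
Proof.
move=> w w' Dw ww'; apply: eq_bigr => i _.
have gE E a b : pd E (fun v => g v a b) w' = pd E (fun v => g v a b) w.
  by apply: pd_base_only ww' => //; exact: g_entry_base.
by rewrite !gE /invm (g_base Dw ww').
Qed.

Lemma cL_base i j k : base_only (cL S i j k).
Proof.
move=> w w' Dw ww'; rewrite !cLE//; last exact: D_fibred ww'.
exact: chrisM_base.
Qed.

Lemma cGE k i ga z : D z -> cG S k i ga z =
  \sum_j invm g k j z / 2%:R * pd (tI ga) (fun w => g w j i) z.
Proof.
move=> Dz; apply: eq_bigr => j _.
by rewrite delta_base_only//; exact: g_entry_base.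
Qed.

Lemma cG_base k i ga : base_only (cG S k i ga).
Proof.
move=> w w' Dw ww'; rewrite !cGE//; last exact: D_fibred ww'.
apply: eq_bigr => j _; rewrite /invm (g_base Dw ww'); congr (_ * _).
by apply: pd_base_only ww' => //; exact: g_entry_base.
Qed.

Lemma conn_xI_base A i l : base_only (conn S A (xI i) (xI l)).
Proof.
case: A => [ga|j|j ga]; [exact: cG_base|exact: cL_base|].
by move=> w w' Dw ww' /=; rewrite !cCE0//; exact: D_fibred ww'.
Qed.

Lemma cH_time_only al be ga : time_only (cH S al be ga).
Proof. exact: lift_h_time_only. Qed.

Lemma curv_xI_base A B i l z : D z -> curv S A B (xI i) (xI l) z =
  delta S A (conn S B (xI i) (xI l)) z - delta S B (conn S A (xI i) (xI l)) z
  + \sum_m conn S B (xI i) (xI m) z * conn S A (xI m) (xI l) z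
  - \sum_m conn S A (xI i) (xI m) z * conn S B (xI m) (xI l) z.
Proof.
move=> Dz; rewrite curv_xI [X in _ - X = _]big1 ?subr0// => m _.
by rewrite big1// => mu _; rewrite cCE0// mulr0.
Qed.

Lemma curv_xtx i l be k z : D z -> curv S (xI k) (tI be) (xI i) (xI l) z =
  delta S (xI k) (cG S l i be) z - delta S (tI be) (chrisM g l i k) z
  + \sum_m cG S m i be z * chrisM g l m k z
  - \sum_m chrisM g m i k z * cG S l m be z.
Proof.
move=> Dz; rewrite curv_xI_base// -(eq_delta_open (tI be) Dz (@cLE l i k)).
by congr (_ + _ - _); apply: eq_bigr => m _; rewrite -cLE.
Qed.

Lemma curv_xxx i l j k z : D z -> curv S (xI k) (xI j) (xI i) (xI l) z =
  pd (xI k) (chrisM g l i j) z - pd (xI j) (chrisM g l i k) z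
  + \sum_m chrisM g m i j z * chrisM g l m k z
  - \sum_m chrisM g m i k z * chrisM g l m j z.
Proof.
move=> Dz; have d E a b c : delta S E (cL S a b c) z = pd E (chrisM g a b c) z.
  rewrite -delta_base_only//; last exact: chrisM_base.
  by apply: eq_delta_open => // w; exact: cLE.
rewrite curv_xI_base//; congr (_ - _ + _ - _); [exact: d|exact: d| |];
  by apply: eq_bigr => m _; rewrite /= !cLE.
Qed.

Lemma curv_eq0_multi_time A B C E z : D z ->
  [|| ~~ same_block C E, is_v A, is_v B | is_t C && ~~ (is_t A && is_t B)] ->
  curv S A B C E z = 0.
Proof.
move=> Dz.
(* A vertical direction contributes coefficients C = 0, and its derivation kills the remaining
   coefficient, which is constant along the fibres. *)
have curv_v j i al F l : curv S (vI i al) F (xI j) (xI l) z = 0.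
  rewrite curv_xI_base// delta_base_only//; last exact: conn_xI_base.
  rewrite pd_v_base_only//; last exact: conn_xI_base.
  rewrite (@eq_delta_open F _ (fun=> 0)) ?delta_cst ?subrr ?add0r//; last first.
    by move=> w Dw; exact: cCE0.
  by rewrite !big1 ?subrr// => m _; rewrite /= cCE0 ?(mulr0, mul0r).
case: (boolP (same_block C E)) => [CE /=|CE _]; last exact: curv_block.
have [AB|] := boolP (is_t A && is_t B).
  by rewrite /= andbF orbF; case: A B AB => [?|?|? ?] [?|?|? ?].
move=> AB; rewrite andbT; have H := cH_time_only.
case: C E CE => [eta|j|j eta] [al|l|l al] // _.
- by move=> _; exact: curv_tI_eq0.
- rewrite [is_t _]/= orbF => /orP[].
    by case: A {AB} => // i be _; exact: curv_v.
  by case: B {AB} => // i be _; rewrite curv_antisym curv_v oppr0.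
- rewrite [is_t _]/= orbF curv_vI_xI// => /orP[].
    by case: A {AB} => // i be _; rewrite curv_v mulr0.
  by case: B {AB} => // i be _; rewrite curv_antisym curv_v oppr0 mulr0.
Qed.

Hypothesis g_unit : forall w, D w -> g w \in unitmx.
Hypothesis h_unit : forall w, D w -> h w.1.1 \in unitmx.
Hypothesis g_C2 : Ck 2 D g.
Hypothesis h_C2 : Ck 2 D (lift_h (n := n) h).

Lemma derivable_entry_pd q (m : jet R p n -> 'M[R]_q) E i j z v : Ck 2 D m -> D z ->
  derivable (pd E (fun w => m w i j)) z v.
Proof.
move=> m2 Dz; apply: (Ck_derivable _ Dz (k := 0)); apply: Ck_derive.
exact: Ck_entry.
Qed.

Lemma derivable_inv_entry q (m : jet R p n -> 'M[R]_q) i j z v : Ck 2 D m ->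
  (forall w, D w -> m w \in unitmx) -> D z ->
  derivable (invm m i j) z v.
Proof.
move=> m2 mu Dz; apply: (derivable_invmx oD Dz mu) => a b.
exact: (Ck_derivable (Ck_entry a b oD m2) Dz).
Qed.

Lemma derivable_cG k i ga z v : D z -> derivable (cG S k i ga) z v.
Proof.
move=> Dz; apply: (@eq_derivable_open _ _ _ D (fun z =>
  \sum_j invm g k j z / 2%:R * pd (tI ga) (fun w => g w j i) z)) => //.
  by move=> w Dw; rewrite cGE.
apply: derivable_sum_seq => j; apply: derivableM; last exact: derivable_entry_pd.
by apply: derivableM; [exact: derivable_inv_entry|exact: derivable_cst].
Qed.

Lemma derivable_cH al be ga z v : D z -> derivable (cH S al be ga) z v.
Proof.
move=> Dz; apply: derivable_sum_seq => mu; apply: derivableM.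
  by apply: derivableM; [exact: derivable_inv_entry|exact: derivable_cst].
by apply: derivableB; [apply: derivableD|]; exact: derivable_entry_pd.
Qed.

(** Here a temporal derivation meets both the G- and the H-part of the vertical coefficient. Both
    are derivable: inverse metrics by Cramer's formula, first derivatives of the metrics by their
    C^2 regularity. *)
Lemma curv_ttv i l al be ga eta z : D z ->
  curv S (tI ga) (tI be) (vI i al) (vI l eta) z =
    (al == eta)%:R * curv S (tI ga) (tI be) (xI i) (xI l) z
    - (l == i)%:R * curv S (tI ga) (tI be) (tI eta) (tI al) z.
Proof.
move=> Dz; rewrite (eq_sym al); apply: curv_vI => A B AB.
have [a [b [-> ->]]] : exists a b, A = tI a /\ B = tI b.
  by case: AB => -[-> ->]; [exists ga, be|exists be, ga].
have E : conn S (tI b) (vI i al) (vI l eta) = fun w =>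
    (eta == al)%:R * cG S l i b w - (l == i)%:R * cH S al eta b w.
  by apply/funext => w; rewrite conn_vI.
have cG_b := @cG_base l i b; have cH_b := time_only_base (@cH_time_only al eta b).
rewrite E (@delta_base_only _ _ z _ Dz); last first.
  by move=> w w' Dw ww'; rewrite (cG_b _ _ Dw ww') (cH_b _ _ Dw ww').
rewrite [delta S _ (conn S _ (xI i) (xI l)) z]
  (@delta_base_only _ _ z cG_b Dz).
rewrite [delta S _ (conn S _ (tI eta) (tI al)) z]
  (@delta_base_only _ _ z cH_b Dz).
have dZ c f : derivable f z (coord_vector R (tI a)) ->
    is_derive z (coord_vector R (tI a)) (fun w => c * f w) (c * pd (tI a) f z).
  by move=> df; apply: is_deriveZ; exact: derivableP.
have := is_deriveB (dZ (eta == al)%:R _ (@derivable_cG l i b z _ Dz))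
  (dZ (l == i)%:R _ (@derivable_cH al eta b z _ Dz)).
by case.
Qed.

End FibredDomain.

(** * Kronecker regular Lagrangians *)

(** The functions phi1(s) - 2 c s and phi(s) - phi1(0) s - c s^2 have zero derivative, hence are
    constant. The factor 2 absorbs the one half of Kronecker regularity. *)
Lemma quadratic_at1 (R : realType) (phi phi1 : R -> R) (c : R) :
    (forall s, is_derive s (1 : R) phi (phi1 s)) ->
    (forall s, is_derive s (1 : R) phi1 (2%:R * c)) ->
  phi 1 = phi 0 + phi1 0 + c.
Proof.
move=> dphi dphi1.
have dlin (k s : R) : is_derive s (1 : R) (fun r => r * k) k.
  by apply: derive_affine => t; rewrite mulrDl; congr (_ * _ + _); exact: mulr1.
have dsqr (k s : R) : is_derive s (1 : R) (fun r => k * (r * r)) (2%:R * k * s).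
  have H := is_deriveZ k
    (is_deriveM (is_derive_id s (1 : R)) (is_derive_id s (1 : R))).
  by refine (is_derive_eq H _); rewrite -[LHS]/(k * (s * 1 + s * 1)); ring.
have e1 s : phi1 s = phi1 0 + 2%:R * c * s.
  have d r : is_derive r (1 : R) (fun r => phi1 r - r * (2%:R * c)) 0.
    by have := is_deriveB (dphi1 r) (dlin (2%:R * c) r); rewrite subrr.
  by have := is_derive_0_is_cst s 0 d; rewrite mul0r subr0 => <-; ring.
have d r : is_derive r (1 : R) (fun r => phi r - r * phi1 0 - c * (r * r)) 0.
  refine (is_derive_eq (is_deriveB (is_deriveB (dphi r) (dlin (phi1 0) r))
    (dsqr c r)) _).
  by rewrite e1; ring.
have := is_derive_0_is_cst 1 0 d.
by rewrite !mul0r mulr0 !subr0 !mul1r mulr1 => <-; ring.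
Qed.

Section KroneckerRegular.
Variables (R : realType) (p n : nat) (D : set (jet R p n)).
Hypothesis oD : open D.
Hypothesis D_fibred : forall w w', D w -> w'.1 = w.1 -> D w'.
Implicit Types (f : jet R p n -> R) (w z : jet R p n).

Definition vertical (A : 'M[R]_(n, p)) : jet R p n := (0, 0, A).

Lemma verticalD : {morph vertical : A B / A + B}.
Proof. by move=> A B; congr pair; congr pair; rewrite /= addr0. Qed.

Lemma verticalZ (c : R) A : vertical (c *: A) = c *: vertical A.
Proof. by congr pair; congr pair; rewrite /= scaler0. Qed.

Lemma vertical_line (s : R) A w : (s *: vertical A + w).1 = w.1.
Proof. rewrite -verticalZ; exact: add0r. Qed.

(** Linearity of the derivative in its direction: additivity from [derive_additive], homogeneity
    from [deriveZv]. *)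
Lemma derive_vertical f z (A : 'M[R]_(n, p)) : smooth D f -> D z ->
  'D_(vertical A) f z = \sum_i \sum_al A i al * pd (vI i al) f z.
Proof.
move=> sf Dz.
have add : {morph (fun v => 'D_v f z) : u v / u + v}.
  move=> u v /=.
  apply: (@derive_additive _ _ D f z u v oD Dz) => [w y Dy|w].
    exact: Ck_derivable (sf 1%N) Dy.
  exact: Ck_continuous (Ck_derive w (sf 1%N)) Dz.
have D0 : 'D_(0 : jet R p n) f z = 0 by exact: derive0.
have V0 : vertical 0 = 0 by [].
rewrite {1}(matrix_sum_delta A) (big_morph _ verticalD V0) (big_morph _ add D0).
apply: eq_bigr => i _; rewrite (big_morph _ verticalD V0) (big_morph _ add D0).
apply: eq_bigr => al _; rewrite verticalZ.
have df : derivable f z (vertical (delta_mx i al)).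
  exact: Ck_derivable (sf 1%N) Dz.
by have [] := deriveZv (A i al) df.
Qed.

Lemma smooth_pd E f : smooth D f -> smooth D (pd E f).
Proof. by move=> sf k; exact: Ck_derive. Qed.

Lemma smooth_derive v f : smooth D f -> smooth D ('D_v f).
Proof. by move=> sf k; exact: Ck_derive. Qed.

Lemma smooth_derive_comm f z u v : smooth D f -> D z ->
  'D_u ('D_v f) z = 'D_v ('D_u f) z.
Proof.
move=> sf Dz; apply: (@derive_comm _ _ D f z u v oD Dz) => [w y Dy|w w' y Dy|w w'].
- exact: Ck_derivable (sf 1%N) Dy.
- exact: Ck_derivable (Ck_derive w (sf 2%N)) Dy.
- exact: Ck_continuous (Ck_derive w' (Ck_derive w (sf 2%N))) Dz.
Qed.

Variables (h : 'rV[R]_p -> 'M[R]_p) (L : jet R p n -> R).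
Variable (g : jet R p n -> 'M[R]_n).
Hypothesis L_smooth : smooth D L.
Hypothesis g_smooth : smooth D g.
Hypothesis h_unit : forall w, D w -> h w.1.1 \in unitmx.
Hypothesis L_regular : forall z, D z -> forall i j al be,
  2%:R^-1 * pd (vI i al) (pd (vI j be) L) z = invmx (h z.1.1) al be * g z i j.
Hypothesis p_ge2 : (2 <= p)%N.

Lemma smooth_g_entry i j : smooth D (fun w => g w i j).
Proof. by move=> k; exact: Ck_entry. Qed.

Lemma pd2_L z i j al be : D z -> pd (vI i al) (pd (vI j be) L) z =
  2%:R * invmx (h z.1.1) al be * g z i j.
Proof.
by move=> Dz; rewrite -mulrA -L_regular// mulrA divff ?mul1r// pnatr_eq0.
Qed.

(* Symmetry of third derivatives gives h^(al be) X = h^(ga be) Y for all be;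
   since p >= 2 we can take al distinct from ga, and contracting with h_(be al)
   kills the right-hand side. *)
Lemma pd_v_g_eq0 k ga i j z : D z -> pd (vI k ga) (fun w => g w i j) z = 0.
Proof.
move=> Dz; have [al alga] : exists al, al != ga.
  have p_gt0 := ltnW p_ge2.
  have [->|] := eqVneq ga (Ordinal p_gt0); first by exists (Ordinal p_ge2).
  by exists (Ordinal p_gt0); rewrite eq_sym.
have third k' ga' i' al' be : pd (vI k' ga') (pd (vI i' al') (pd (vI j be) L)) z =
    2%:R * invmx (h z.1.1) al' be * pd (vI k' ga') (fun w => g w i' j) z.
  rewrite (@eq_pd _ _ _ D oD _ _
    (fun w => 2%:R * invmx (h w.1.1) al' be * g w i' j)) //; last first.
    by move=> w Dw; exact: pd2_L.
  apply: (@deriveM_const _ _ (fun w => g w i' j)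
    (fun w => 2%:R * invmx (h w.1.1) al' be)).
    exact: Ck_derivable (smooth_g_entry i' j 1%N) Dz.
  by move=> s /=; rewrite scaler0 add0r.
have E be : invmx (h z.1.1) al be * pd (vI k ga) (fun w => g w i j) z =
    invmx (h z.1.1) ga be * pd (vI i al) (fun w => g w k j) z.
  have two0 : (2%:R : R) != 0 by rewrite pnatr_eq0.
  apply: (mulfI two0); rewrite !mulrA -!third.
  exact: smooth_derive_comm (smooth_pd (vI j be) L_smooth) Dz.
have := mulVmx (h_unit Dz) => /matrixP H.
have H1 := H al al; have H0 := H ga al; rewrite !mxE eqxx in H1.
rewrite !mxE eq_sym (negPf alga) in H0.
rewrite -[LHS]mul1r -[1]H1 mulr_suml.
under eq_bigr do rewrite mulrAC E mulrAC.
by rewrite -mulr_suml H0 mul0r.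
Qed.

(** D contains whole fibres, so the straight line from w to w' stays in D, and the entries of g have
    zero derivative along it. *)
Lemma g_fibre_const w w' : D w -> w'.1 = w.1 -> g w' = g w.
Proof.
move=> Dw ww'; apply/matrixP => i j; set v := vertical (w'.2 - w.2).
have Dl (s : R) : D (s *: v + w).
  by apply: (D_fibred Dw); exact: vertical_line.
have e : w' = 1 *: v + w.
  rewrite scale1r; case: w w' ww' @v {Dw Dl} => [w1 w2] [w1' w2'] /= -> /=.
  by congr pair; rewrite /= ?add0r ?subrK.
have := @is_derive_0_is_cst _ (fun s : R => g (s *: v + w) i j) 1 0.
rewrite -e scale0r add0r; apply => s.
have -> : 0 = 'D_v (fun w => g w i j) (s *: v + w).
  rewrite derive_vertical//; last exact: smooth_g_entry.
  by rewrite big1// => k _; rewrite big1// => ga _; rewrite pd_v_g_eq0// mulr0.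
exact: (@is_derive_line _ _ (fun w => g w i j) w v s
  (Ck_derivable (smooth_g_entry i j 1%N) (Dl s))).
Qed.

Lemma L_polynomial z : D z -> L z =
  \sum_al \sum_be \sum_i \sum_j
    invmx (h z.1.1) al be * g z i j * z.2 i al * z.2 j be
  + \sum_i \sum_al pd (vI i al) L (z.1, 0) * z.2 i al + L (z.1, 0).
Proof.
move=> Dz; set w0 : jet R p n := (z.1, 0); set v := vertical z.2.
have Dl (s : R) : D (s *: v + w0).
  by apply: (D_fibred Dz); exact: vertical_line.
have Dw0 : D w0 by have := Dl 0; rewrite scale0r add0r.
set q := \sum_al _.
(* The fibre Hessian of L is 2 h^(al be) g_ij, and both factors are constant along the fibre; hence
   the value is the same for all s. *)
have d2 s : 'D_v ('D_v L) (s *: v + w0) = 2%:R * q.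
  rewrite derive_vertical//; last exact: smooth_derive.
  rewrite /q mulr_sumr; have w1 : (s *: v + w0).1 = z.1 by exact: vertical_line.
  transitivity (\sum_i \sum_al \sum_j \sum_be
      2%:R * (invmx (h z.1.1) be al * g z j i * z.2 j be * z.2 i al)).
    apply: eq_bigr => i _; apply: eq_bigr => al _.
    (* [derive_vertical] applies pointwise to an outermost derivative, so symmetry first brings the
       remaining 'D_v outside. *)
    rewrite {1}/pd smooth_derive_comm// derive_vertical//; last exact: smooth_pd.
    rewrite mulr_sumr; apply: eq_bigr => j _.
    rewrite mulr_sumr; apply: eq_bigr => be _.
    by rewrite pd2_L// (g_fibre_const Dz w1) w1; ring.
  rewrite exchange_big; under eq_bigr => al _.
    under eq_bigr => i _ do rewrite exchange_big.
    rewrite exchange_big; over.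
  rewrite exchange_big; apply: eq_bigr => be _.
  rewrite mulr_sumr; apply: eq_bigr => al _.
  rewrite exchange_big mulr_sumr; apply: eq_bigr => j _; rewrite mulr_sumr.
  by apply: eq_bigr => i _.
have dL s : is_derive s (1 : R) (fun s => L (s *: v + w0)) ('D_v L (s *: v + w0)).
  exact: is_derive_line (Ck_derivable (L_smooth 1%N) (Dl s)).
have dL2 s : is_derive s (1 : R) (fun s => 'D_v L (s *: v + w0)) (2%:R * q).
  rewrite -(d2 s).
  exact: is_derive_line (Ck_derivable (Ck_derive v (L_smooth 2%N)) (Dl s)).
have := quadratic_at1 dL dL2; rewrite scale0r add0r derive_vertical//.
have -> : 1 *: v + w0 = z.
  rewrite scale1r /v /w0; case: (z) => z1 z2.
  by congr pair; rewrite /= ?add0r ?addr0.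
move=> ->; rewrite addrC (addrC (L w0)) addrA; congr (_ + _ + _).
by apply: eq_bigr => i _; apply: eq_bigr => al _; rewrite mulrC.
Qed.

End KroneckerRegular.

(** * Chart domains of the jet bundle *)

Section JetCharts.
Variables (R : realType) (p n : nat) (T M : topologicalType).
Variables (XT : manifold R T p) (XM : manifold R M n).
Implicit Types (a : chart_index XT) (b : chart_index XM) (z w : jet R p n).

Lemma continuous_base_t : continuous (fun z : jet R p n => z.1.1).
Proof. by move=> z; apply: continuous_comp; exact: cvg_fst. Qed.

Lemma continuous_base_x : continuous (fun z : jet R p n => z.1.2).
Proof. by move=> z; apply: continuous_comp; [exact: cvg_fst|exact: cvg_snd]. Qed.

Lemma open_jet_range a b : open (@jet_range R p n T M XT XM a b).
Proof.
apply: openI.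
  apply: (@open_comp _ _ (fun z : jet R p n => z.1.1)).
    by move=> z _; exact: continuous_base_t.
  exact: chart_range_open.
apply: (@open_comp _ _ (fun z : jet R p n => z.1.2)).
  by move=> z _; exact: continuous_base_x.
exact: chart_range_open.
Qed.

Lemma jet_range_fibred a b w w' : jet_range a b w -> w'.1 = w.1 -> jet_range a b w'.
Proof. by rewrite /jet_range /= => + ->. Qed.

Lemma trans_range d (X : topologicalType) (A : manifold R X d)
    (a a' : chart_index A) x :
  overlap a a' x -> chart_range a' (trans a a' x).
Proof.
by move=> [t [ta ta'] <-]; rewrite /trans /= chartK//; exists t.
Qed.

Lemma jet_trans_range a a' b b' z :
  jet_overlap a a' b b' z -> jet_range a' b' (jet_trans a a' b b' z).
Proof. by move=> [ta xb]; split; exact: trans_range. Qed.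

Lemma smooth_lift_h a b (h : chart_index XT -> 'rV[R]_p -> 'M[R]_p) :
  semi_riemannian h -> smooth (jet_range a b) (lift_h (n := n) (h a)).
Proof.
move=> [sh _ _ _] k.
apply: (@Ck_comp_linear _ _ _ _ _ _ (chart_range a)
  (fun z : jet R p n => z.1.1)) => //.
- exact: continuous_base_t.
- by move=> z [].
- exact: sh.
Qed.

End JetCharts.

Lemma has_signature_unit (R : realType) d r (S : 'M[R]_d) :
  has_signature r S -> S \in unitmx.
Proof.
move=> [Q Qu] /(congr1 determinant); rewrite !det_mulmx det_diag => E.
rewrite unitmxE unitfE; apply/eqP => S0; move: E.
rewrite S0 mulr0 mul0r => /esym/eqP; apply/negP/prodf_neq0 => i _; rewrite mxE.
by case: ifP => _; rewrite ?oppr_eq0 oner_neq0.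
Qed.

Lemma mul_delta_mul (R : pzRingType) m1 m2 m3 m4 (J : 'M[R]_(m1, m2))
    (K : 'M[R]_(m3, m4)) i j k l :
  (J *m delta_mx i j *m K) k l = J k i * K j l.
Proof.
rewrite mxE (bigD1 j)//= big1 => [|j' j'j]; rewrite mxE (bigD1 i)//= big1.
- by rewrite mxE !eqxx mulr1 !addr0.
- by move=> i' i'i; rewrite mxE (negPf i'i) mulr0.
- by rewrite mxE eqxx (negPf j'j) mulr0 addr0 mul0r.
- by move=> i' i'i; rewrite mxE (negPf i'i) mulr0.
Qed.

(** * The global tensors U and F of the polynomial form *)

Section LagrangeTensors.
Variables (R : realType) (p n : nat) (T M : topologicalType).
Variables (XT : manifold R T p) (XM : manifold R M n).
Variable (h : chart_index XT -> 'rV[R]_p -> 'M[R]_p).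
Variable (L : chart_index XT -> chart_index XM -> jet R p n -> R).
Variable (g : chart_index XT -> chart_index XM -> jet R p n -> 'M[R]_n).
Hypotheses (h_metric : semi_riemannian h) (L_space : lagrange_space h L g).
Implicit Types (a : chart_index XT) (b : chart_index XM) (z w : jet R p n).

Lemma h_unit a b w : jet_range a b w -> h a w.1.1 \in unitmx.
Proof.
move=> [ta _]; have [_ _ [r hr] _] := h_metric.
exact: has_signature_unit (hr a _ ta).
Qed.

Lemma g_unit a b w : jet_range a b w -> g a b w \in unitmx.
Proof.
move=> Dw; have [_ _ /(_ a b w Dw)[_ rk] _ _] := L_space.
by rewrite -row_free_unit /row_free rk.
Qed.

Definition zero_section z : jet R p n := (z.1, 0).

Lemma continuous_zero_section : continuous zero_section.
Proof.
move=> z; rewrite /continuous_at /zero_section.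
apply: (@cvg_pair _ _ _ (nbhs z) (nbhs z.1) (nbhs (0 : 'M[R]_(n, p)))
  _ _ _ fst (cst 0)); [exact: cvg_fst|exact: cvg_cst].
Qed.

Lemma smooth_zero_section a b (f : jet R p n -> R) :
  smooth (jet_range a b) f -> smooth (jet_range a b) (f \o zero_section).
Proof.
move=> sf k.
apply: (Ck_comp_linear _ continuous_zero_section _ (sf k)) => [s v x|x Dx].
  by congr pair; rewrite /= scaler0 addr0.
exact: jet_range_fibred Dx _.
Qed.

(** The linear Taylor coefficient of L along the fibre at the zero section, which serves as U. *)
Definition fibre_derivative a b z : 'M[R]_(n, p) :=
  \matrix_(i, al) pd (vI i al) (L a b) (zero_section z).

Definition zero_value a b z : R := L a b (zero_section z).

Lemma L_smooth a b : smooth (jet_range a b) (L a b).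
Proof. by have [[]] := L_space. Qed.

(** Chart changes are linear in x^i_al, so the zero section is globally defined and Taylor
    coefficients taken on it can transform tensorially. *)
Lemma jet_trans_zero a a' b b' z :
  jet_trans a a' b b' (zero_section z) = zero_section (jet_trans a a' b b' z).
Proof. by rewrite /jet_trans /zero_section /= mulmx0 mul0mx. Qed.

Lemma zero_value_scalar : d_scalar zero_value.
Proof.
split=> [a b|a a' b b' z ov]; first exact: smooth_zero_section (L_smooth a b).
have [[_ Linv] _ _ _ _] := L_space.
by rewrite /zero_value (Linv a a' b b')// jet_trans_zero.
Qed.

(** Fibrewise linearity of the chart change replaces the chain rule: a line along d/dx^i_al goes to
    a line in the other chart, whose direction is then expanded by [derive_vertical]. *)
Lemma fibre_derivative_tensor : d_tensor_U fibre_derivative.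
Proof.
split=> [a b k|a a' b b' z ov].
  apply: Ck_mx => [|i al]; first exact: open_jet_range.
  rewrite (_ : (fun x => _) = pd (vI i al) (L a b) \o zero_section).
    exact: (smooth_zero_section (smooth_pd (vI i al) (@L_smooth a b)) k).
  by apply/funext => w; rewrite mxE.
set J := jac (trans b b') z.1.2; set K := jac (trans a' a) _.
have [[_ Linv] _ _ _ _] := L_space.
have ovl w : w.1 = z.1 -> jet_overlap a a' b b' w by rewrite /jet_overlap /= => ->.
apply/matrixP => i al; rewrite !mxE.
(* The image direction is the coordinate matrix [delta_mx i al] transported by the fibre action A ->
   J A K. *)
transitivity ('D_(vertical (J *m delta_mx i al *m K)) (L a' b')
    (zero_section (jet_trans a a' b b' z))).
  apply: eq_derive_line => s; rewrite (Linv a a' b b'); last first.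
    by apply: ovl; exact: (vertical_line s (delta_mx i al) (zero_section z)).
  congr (L a' b' _); rewrite /jet_trans.
  rewrite (vertical_line s (delta_mx i al) (zero_section z)) -verticalZ /=.
  rewrite addr0 -scalemxAr -scalemxAl; congr pair; last by rewrite /= addr0.
  exact/esym/add0r.
have Dz' : jet_range a' b' (zero_section (jet_trans a a' b b' z)).
  exact: jet_range_fibred (jet_trans_range ov) _.
rewrite (derive_vertical (@open_jet_range _ _ _ _ _ _ _ a' b') _
  (@L_smooth a' b') Dz').
rewrite exchange_big; apply: eq_bigr => be _; rewrite !mxE mulr_suml.
by apply: eq_bigr => j _; rewrite mul_delta_mul !mxE mulrAC.
Qed.

Lemma g_fibre_constant : (2 <= p)%N -> fibre_constant g.
Proof.
move=> p2 a b z z' Dz zz'.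
have [_ [sg _] _ _ reg] := L_space.
apply: (g_fibre_const (open_jet_range (a := a) (b := b))
  (@jet_range_fibred _ _ _ _ _ _ _ a b) (@L_smooth a b) (sg a b)
  (@h_unit a b) (reg a b) p2 Dz zz').
Qed.

Lemma polynomial_form_exists : (2 <= p)%N -> exists U F, polynomial_form h L g U F.
Proof.
move=> p2; exists fibre_derivative, zero_value; split.
- split; first exact: g_fibre_constant.
    by move=> a b z z' _ e; rewrite /fibre_derivative /zero_section e.
  by move=> a b z z' _ e; rewrite /zero_value /zero_section e.
- exact: fibre_derivative_tensor.
- exact: zero_value_scalar.
- move=> a b z Dz; have [_ [sg _] _ _ reg] := L_space.
  rewrite (L_polynomial (open_jet_range (a := a) (b := b))
    (@jet_range_fibred _ _ _ _ _ _ _ a b) (@L_smooth a b) (sg a b)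
    (@h_unit a b) (reg a b) p2 Dz).
  by congr (_ + _ + _); apply: eq_bigr => i _; apply: eq_bigr => al _; rewrite mxE.
Qed.

End LagrangeTensors.

Theorem theorem4p5 (R : realType) (p n : nat) (T M : topologicalType)
    (XT : manifold R T p) (XM : manifold R M n)
    (h : chart_index XT -> 'rV[R]_p -> 'M[R]_p)
    (L : chart_index XT -> chart_index XM -> jet R p n -> R)
    (g : chart_index XT -> chart_index XM -> jet R p n -> 'M[R]_n)
    (h_metric : semi_riemannian h) (L_space : lagrange_space h L g) :
  (p = 1%N ->
   forall (o : 'I_p) (a : chart_index XT) (b : chart_index XM) (z : jet R p n),
   jet_range a b z ->
   let S := cartan1 (h a) (L a b) (g a b) in
   [/\ (forall i l k,
          curv S (xI k) (tI o) (xI i) (xI l) z =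
            delta S (xI k) (cG S l i o) z - delta S (tI o) (cL S l i k) z
            + \sum_m cG S m i o z * cL S l m k z
            - \sum_m cL S m i k z * cG S l m o z
            + \sum_m cC S l i m o z * torRt S o m k z)
       /\ (forall i l k,
          curv S (xI k) (tI o) (vI i o) (vI l o) z =
            curv S (xI k) (tI o) (xI i) (xI l) z),
       (forall i l j k,
          curv S (xI k) (xI j) (xI i) (xI l) z =
            delta S (xI k) (cL S l i j) z - delta S (xI j) (cL S l i k) z
            + \sum_m cL S m i j z * cL S l m k z
            - \sum_m cL S m i k z * cL S l m j z
            + \sum_m cC S l i m o z * torRx S o m j k z)
       /\ (forall i l j k,
          curv S (xI k) (xI j) (vI i o) (vI l o) z =
            curv S (xI k) (xI j) (xI i) (xI l) z),
       (forall i l k,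
          curv S (vI k o) (tI o) (xI i) (xI l) z =
            pd (vI k o) (cG S l i o) z - covCt S o l i k z
            + \sum_m cC S l i m o z * torPt S o m k z)
       /\ (forall i l k,
          curv S (vI k o) (tI o) (vI i o) (vI l o) z =
            curv S (vI k o) (tI o) (xI i) (xI l) z),
       (forall i l j k,
          curv S (vI k o) (xI j) (xI i) (xI l) z =
            pd (vI k o) (cL S l i j) z - covCx S o l i k j z
            + \sum_m cC S l i m o z * torPx S o m j k z)
       /\ (forall i l j k,
          curv S (vI k o) (xI j) (vI i o) (vI l o) z =
            curv S (vI k o) (xI j) (xI i) (xI l) z)
     & [/\ (forall i l j k,
          curv S (vI k o) (vI j o) (xI i) (xI l) z =
            pd (vI k o) (cC S l i j o) z - pd (vI j o) (cC S l i k o) z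
            + \sum_m cC S m i j o z * cC S l m k o z
            - \sum_m cC S m i k o z * cC S l m j o z),
       (forall i l j k,
          curv S (vI k o) (vI j o) (vI i o) (vI l o) z =
            curv S (vI k o) (vI j o) (xI i) (xI l) z),
       (forall A B C D, curv S A B C D z = - curv S B A C D z)
     & (* all other adapted components vanish *)
       (forall A B C D,
          [|| ~~ same_block C D, is_t C | is_t A && is_t B] ->
          curv S A B C D z = 0)]])
  /\

  ((2 <= p)%N ->
   (exists U F, polynomial_form h L g U F) /\
   (forall U F, polynomial_form h L g U F ->
    forall (a : chart_index XT) (b : chart_index XM) (z : jet R p n),
    jet_range a b z ->
    let S := cartan2 (h a) (U a b) (g a b) in
    [/\ (forall al be ga eta,
           curv S (tI ga) (tI be) (tI eta) (tI al) z =
             pd (tI ga) (cH S al eta be) z - pd (tI be) (cH S al eta ga) z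
             + \sum_mu cH S mu eta be z * cH S al mu ga z
             - \sum_mu cH S mu eta ga z * cH S al mu be z),
        (forall i l be ga,
           curv S (tI ga) (tI be) (xI i) (xI l) z =
             delta S (tI ga) (cG S l i be) z - delta S (tI be) (cG S l i ga) z
             + \sum_m cG S m i be z * cG S l m ga z
             - \sum_m cG S m i ga z * cG S l m be z)
        /\ (forall i l al be ga eta,
           curv S (tI ga) (tI be) (vI i al) (vI l eta) z =
             (al == eta)%:R * curv S (tI ga) (tI be) (xI i) (xI l) z
             - (l == i)%:R * curv S (tI ga) (tI be) (tI eta) (tI al) z),
        (forall i l be k,
           curv S (xI k) (tI be) (xI i) (xI l) z =
             delta S (xI k) (cG S l i be) z
             - delta S (tI be) (chrisM (g a b) l i k) z
             + \sum_m cG S m i be z * chrisM (g a b) l m k z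
             - \sum_m chrisM (g a b) m i k z * cG S l m be z)
        /\ (forall i l al be eta k,
           curv S (xI k) (tI be) (vI i al) (vI l eta) z =
             (al == eta)%:R * curv S (xI k) (tI be) (xI i) (xI l) z),
        (forall i l j k,
           curv S (xI k) (xI j) (xI i) (xI l) z =
             pd (xI k) (chrisM (g a b) l i j) z
             - pd (xI j) (chrisM (g a b) l i k) z
             + \sum_m chrisM (g a b) m i j z * chrisM (g a b) l m k z
             - \sum_m chrisM (g a b) m i k z * chrisM (g a b) l m j z)
        /\ (forall i l al eta j k,
           curv S (xI k) (xI j) (vI i al) (vI l eta) z =
             (al == eta)%:R * curv S (xI k) (xI j) (xI i) (xI l) z)
      & (forall A B C D, curv S A B C D z = - curv S B A C D z)
        /\ (* all other adapted components vanish *)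
        (forall A B C D,
           [|| ~~ same_block C D, is_v A, is_v B
             | is_t C && ~~ (is_t A && is_t B)] ->
           curv S A B C D z = 0)])).

Proof.
split=> [p1 o a b z Dz S|p2].
  have cH_t al be ga : time_only (cH S al be ga) by exact: lift_h_time_only.
  subst p; rewrite (ord1 o).
  split; [split|split|split|split|].
  - by move=> i l k; exact: curv_xt1.
  - by move=> i l k; rewrite curv_vI_xI// eqxx mul1r.
  - by move=> i l j k; exact: curv_xx1.
  - by move=> i l j k; rewrite curv_vI_xI// eqxx mul1r.
  - by move=> i l k; exact: curv_vt1.
  - by move=> i l k; rewrite curv_vI_xI// eqxx mul1r.
  - by move=> i l j k; exact: curv_vx1.
  - by move=> i l j k; rewrite curv_vI_xI// eqxx mul1r.
  - split; first by move=> i l j k; exact: curv_vv1.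
    + by move=> i l j k; rewrite curv_vI_xI// eqxx mul1r.
    + by move=> A B C D; exact: curv_antisym.
    + by move=> A B C D; exact: curv_eq0_one_time.
split; first exact: polynomial_form_exists.
move=> U F [[g_fc _ _] _ _ _] a b z Dz S.
have oD := @open_jet_range R p n T M XT XM a b.
have fD := @jet_range_fibred R p n T M XT XM a b.
have gD : forall w w', jet_range a b w -> w'.1 = w.1 -> g a b w' = g a b w.
  exact: g_fc.
have [_ [sg _] gP _ reg] := L_space.
have gS w : jet_range a b w -> (g a b w)^T = g a b w by move=> /gP[].
have nt A B : ~~ (is_t A && is_t B) -> forall i l al eta,
    curv S A B (vI i al) (vI l eta) z =
    (al == eta)%:R * curv S A B (xI i) (xI l) z.
  by move=> AB i l al eta; apply: curv_vI_xI => // *; exact: lift_h_time_only.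
(* Exposes the connection data in the shape [ConnectionData (lift_h h) g N], for which the results
   on fibre-constant metrics are stated. *)
rewrite /S /cartan2 in nt *; split; [| split | split | split | split].
- by move=> al be ga eta; apply: curv_ttt => *; exact: lift_h_time_only.
- by move=> i l be ga; exact: (@curv_xI_base _ _ _ _ _ _ _ gD).
- move=> i l al be ga eta.
  have hC2 : Ck 2 (jet_range a b) (lift_h (n := n) (h a)).
    exact: smooth_lift_h.
  have gu w : jet_range a b w -> g a b w \in unitmx.
    by move=> Dw; exact: g_unit L_space _ _ _ Dw.
  have hu w : jet_range a b w -> h a w.1.1 \in unitmx.
    by move=> Dw; exact: h_unit h_metric _ _ _ Dw.
  exact: (curv_ttv oD fD _ gD gu hu (sg a b 2) hC2).
- by move=> i l be k; apply: curv_xtx Dz.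
- by move=> i l al be eta k; exact: nt.
- by move=> i l j k; apply: curv_xxx Dz.
- by move=> i l al eta j k; exact: nt.
- by move=> A B C D; exact: curv_antisym.
- by move=> A B C D; apply: curv_eq0_multi_time Dz.
Qed.
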